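(* Let $\nu\ge 3$ be a fixed integer. For $G\in\{\mathbb{T},SO(2),O(3)\}$ let $\mathcal{A}_G(\nu,D)$ be the set of auxiliary nodes inserted by Algorithm 1 (specified in the context) and let $\mathcal{V}_G(\nu,D)=\mathcal{A}_G(\nu,D)\cup\bigcup_{\nu'=1}^{\nu}\mathcal{K}_G(\nu',D)$. (i) If $G=SO(2)$ or $G=O(3)$, then as $D\to\infty$ $$\frac{\#\mathcal{A}_{SO(2)}(\nu,D)}{\#\mathcal{V}_{SO(2)}(\nu,D)}=O\left(\frac1D\right),\qquad \frac{\#\mathcal{A}_{O(3)}(\nu,D)}{\#\mathcal{V}_{O(3)}(\nu,D)}=O\left(\frac1{D^2}\right).$$ (ii) If $G=\mathbb{T}$, then Algorithm 1 inserts exactly $$\#\mathcal{A}_{\mathbb{T}}(\nu,D)=2\sum_{k=2}^{\nu-1}\ \sum_{n=1}^{\lfloor D/2\rfloor}\pi(k,n)$$ auxiliary nodes, where $\pi(k,n)$ is the number of integer partitions of $n$ into exactly $k$ (positive) parts. Moreover, $$\lim_{D\to\infty}\frac{\#\mathcal{A}_{\mathbb{T}}(\nu,D)}{\#\mathcal{V}_{\mathbb{T}}(\nu,D)}=\frac{1}{1+C_{\nu-1}/2},\qquad\text{where } C_{\nu-1}=\frac{1}{\nu-1}\binom{2\nu-2}{\nu-2},$$ i.e. $C_{\nu-1}$ is the $(\nu-1)$th Catalan number.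
   Context: $D$ ranges over positive integers, $\mathbb{Z}_+=\{0,1,2,\dots\}$, $\#$ denotes cardinality, and $[\cdot]$ denotes a multiset (unordered, with repetitions). A multi-index (node) is a finite multiset $\mathbf{k}=[k^1,\dots,k^\nu]$ of one-particle indices; $\nu=\nu(\mathbf{k})=\mathrm{len}(\mathbf{k})\ge 1$ is its correlation order. The one-particle indices are: $k^t=m^t\in\mathbb{Z}$ if $G=\mathbb{T}$; $k^t=(n^t,m^t)\in\mathbb{Z}_+\times\mathbb{Z}$ if $G=SO(2)$; $k^t=(n^t,l^t,m^t)\in\mathbb{Z}_+\times\mathbb{Z}_+\times\mathbb{Z}$ with $|m^t|\le l^t$ if $G=O(3)$. The set $\mathcal{K}^{\rm inv}_G$ of invariant multi-indices consists of all multisets $\mathbf{k}$ (of any order $\nu\ge1$) of one-particle indices with $\sum_t m^t=0$ and, if $G=O(3)$, additionally $\sum_t l^t$ even. The degree of a one-particle index $k$ is $\|k\|=|m|$ for $\mathbb{T}$, $n+|m|$ for $SO(2)$, $n+l$ for $O(3)$, and the total degree of a multi-index is $\|\mathbf{k}\|_1=\sum_t\|k^t\|$. Set $$\mathcal{K}_G(\nu,D)=\{\mathbf{k}\in\mathcal{K}^{\rm inv}_G : \|\mathbf{k}\|_1\le D,\ \nu(\mathbf{k})=\nu\}.$$ A decomposition $\mathbf{k}\equiv[\mathbf{k}_1,\mathbf{k}_2]$ means that $\mathbf{k}$ is the multiset union (multiplicities added) of two nonempty multisets $\mathbf{k}_1,\mathbf{k}_2$ of one-particle indices (not necessarily invariant).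 Graph construction. The computational graph $\mathcal{G}$ initially contains all order-one nodes $[k]$ with $\|k\|\le D$. Then all elements of $\mathcal{K}_G(\nu',D)$, $\nu'=1,\dots,\nu$, are inserted one by one in increasing order of correlation $\nu'$ (arbitrary order within the same $\nu'$), each by calling Insert. Algorithm 1, Insert($\mathbf{k}$): (1) If $\mathbf{k}\in\mathcal{G}$, return. (2) If there is a decomposition $\mathbf{k}\equiv[\mathbf{k}_1,\mathbf{k}_2]$ with $\mathbf{k}_1,\mathbf{k}_2\in\mathcal{G}$, add $\mathbf{k}$ to $\mathcal{G}$ (with this decomposition) and return. (3) Otherwise write $\mathbf{k}\equiv[[k^1],\mathbf{k}']$, where $k^1$ is an element of $\mathbf{k}$ of largest degree $\|k^1\|$ (ties broken arbitrarily); call Insert($\mathbf{k}'$), then call Insert($\mathbf{k}$), and return. The set $\mathcal{A}_G(\nu,D)$ of auxiliary nodes consists of the nodes of the final graph of correlation order at least $2$ that do not belong to $\bigcup_{\nu'=1}^{\nu}\mathcal{K}_G(\nu',D)$ (the initial order-one nodes are not counted as auxiliary). *)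

(* Defs.v *)
From HB Require Import structures.
From mathcomp Require Import all_boot all_order all_algebra.
From mathcomp Require Import finmap multiset.
From mathcomp Require Import all_classical all_reals all_analysis.

Set Implicit Arguments.
Unset Strict Implicit.
Unset Printing Implicit Defensive.

Import Order.TTheory GRing.Theory Num.Theory.
Import numFieldNormedType.Exports.

Local Open Scope classical_set_scope.
Local Open Scope mset_scope.

Inductive symmetry : Set := Torus | SO2 | O3.

(* One-particle indices: m, (n, m), and (n, l, m) with |m| <= l. *)
Definition index (G : symmetry) : choiceType :=
  match G with
  | Torus => int
  | SO2 => (nat * int)%type
  | O3 => {x : nat * nat * int | (absz x.2 <= x.1.2)%N}
  end.

Definition mnum (G : symmetry) : index G -> int :=
  match G return index G -> int with
  | Torus => fun m => m
  | SO2 => fun x => x.2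
  | O3 => fun x => (val x).2
  end.

Definition deg (G : symmetry) : index G -> nat :=
  match G return index G -> nat with
  | Torus => fun m => absz m
  | SO2 => fun x => (x.1 + absz x.2)%N
  | O3 => fun x => ((val x).1.1 + (val x).1.2)%N
  end.

Notation node G := {mset index G}.

Definition even_lsum (G : symmetry) : node G -> bool :=
  match G return node G -> bool with
  | O3 => fun k => ~~ odd (\sum_(x <- k) (val x).1.2)%N
  | _ => fun _ => true
  end.

Definition invariant_node (G : symmetry) (k : node G) : bool :=
  [&& (0 < size k)%N, (\sum_(x <- k) mnum x == 0)%R & even_lsum k].

Definition total_deg (G : symmetry) (k : node G) : nat :=
  (\sum_(x <- k) deg x)%N.

Definition inv_nodes (G : symmetry) (nu D : nat) : set (node G) :=
  [set k | [/\ invariant_node k, (total_deg k <= D)%N & size k = nu]].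

Arguments inv_nodes : clear implicits.

Definition inv_nodes_upto (G : symmetry) (nu D : nat) : set (node G) :=
  \bigcup_(nu' in [set i | (1 <= i <= nu)%N]) inv_nodes G nu' D.

Arguments inv_nodes_upto : clear implicits.

Definition decomposes (G : symmetry) (k k1 k2 : node G) : Prop :=
  [/\ k1 <> mset0, k2 <> mset0 & k = k1 `+` k2].

(* [insert g k g'] : inserting the node [k] into the graph [g] can return the
   graph [g'].  It is a relation because an element of largest degree is chosen
   arbitrarily in [insert_recursive].  Only the nodes of the graphs are
   recorded, not the decompositions attached to them. *)
Inductive insert (G : symmetry) :
    set (node G) -> node G -> set (node G) -> Prop :=
| insert_present g k : g k -> insert g k g
| insert_decomposable g k k1 k2 :
    ~ g k -> decomposes k k1 k2 -> g k1 -> g k2 ->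
    insert g k (k |` g)%classic
| insert_recursive g g' g'' k x k' :
    ~ g k ->
    (forall k1 k2, decomposes k k1 k2 -> ~ (g k1 /\ g k2)) ->
    decomposes k [mset x] k' ->
    (forall y, y \in k -> (deg y <= deg x)%N) ->
    insert g k' g' -> insert g' k g'' ->
    insert g k g''.

Inductive insert_all (G : symmetry) :
    set (node G) -> seq (node G) -> set (node G) -> Prop :=
| insert_all_nil g : insert_all g [::] g
| insert_all_cons g g' g'' k s :
    insert g k g' -> insert_all g' s g'' -> insert_all g (k :: s) g''.

Definition initial_graph (G : symmetry) (D : nat) : set (node G) :=
  [set [mset x] | x in [set x : index G | (deg x <= D)%N]].

Arguments initial_graph : clear implicits.

(* [g] is a possible final graph, for some admissible order [s] of insertion
   and some way of breaking the ties. *)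
Definition final_graph (G : symmetry) (nu D : nat) (g : set (node G)) : Prop :=
  exists s : seq (node G),
    [/\ uniq s, [set` s] = inv_nodes_upto G nu D,
        sorted leq [seq size (enum_mset k) | k <- s] &
        insert_all (initial_graph G D) s g].

Definition aux_nodes (G : symmetry) (nu D : nat) (g : set (node G)) :
    set (node G) :=
  [set k | [/\ g k, (2 <= size k)%N & ~ inv_nodes_upto G nu D k]].

Definition all_nodes (G : symmetry) (nu D : nat) (g : set (node G)) :
    set (node G) :=
  (aux_nodes nu D g `|` inv_nodes_upto G nu D)%classic.

(* Meaningful on finite sets only (it is 0 on infinite ones); the sets it is
   used for are finite by [finite_aux_nodes] and [finite_all_nodes]. *)
Definition card_set (T : choiceType) (A : set T) : nat := #|` fset_set A |.

Definition aux_ratio (R : realType) (G : symmetry) (nu D : nat)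
    (g : set (node G)) : R :=
  ((card_set (aux_nodes nu D g))%:R / (card_set (all_nodes nu D g))%:R)%R.

(* pi(k, n): a partition is the nonincreasing sequence of its parts. *)
Definition num_partitions (k n : nat) : nat :=
  #|[pred t : k.-tuple 'I_n.+1 |
      let s := [seq nat_of_ord i | i <- t] in
      [&& sorted geq s, all (fun i => 0 < i)%N s & sumn s == n]]|.

Definition catalan (R : realType) (n : nat) : R :=
  ('C(2 * n, n)%:R / n.+1%:R)%R.

Section wellposed.
Local Open Scope nat_scope.

Lemma finite_index (G : symmetry) (D : nat) :
  finite_set [set x : index G | deg x <= D].
Proof.
pose I : set nat := [set n : nat | n <= D].
have fI : finite_set I.
  by rewrite (_ : I = `I_D.+1) //; apply/seteqP; split.
pose Z : set int := [set z : int | absz z <= D].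
have fZ : finite_set Z.
  pose f (p : nat * nat) : int := (p.1%:Z - p.2%:Z)%R.
  apply: (@sub_finite_set _ _ [set f p | p in (I `*` I)%classic]).
    move=> [n|n] h; first by exists (n, 0) => //=; rewrite /f subr0.
    by exists (0, n.+1) => //=; rewrite /f sub0r NegzE.
  by apply: finite_image; apply: finite_setX.
case: G => //=.
  apply: (@sub_finite_set _ _ (I `*` Z)%classic); last exact: finite_setX.
  move=> [n m] /= h; split => /=; apply: leq_trans h.
    exact: leq_addr.
  exact: leq_addl.
pose B := ((I `*` I) `*` Z)%classic.
pose h (x : nat * nat * int) : option (index O3) := insub x.
apply: (@sub_finite_set _ _ [set odflt (Sub (0, 0, 0%R) isT : index O3) (h x) | x in B]).
  move=> x hx; exists (val x); last by rewrite /h valK.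
  case: x hx => -[[n l] m] /= hm hx; split => /=; last first.
    by apply: leq_trans hm _; apply: leq_trans hx; exact: leq_addl.
  by split => /=; apply: leq_trans hx; rewrite ?leq_addl ?leq_addr.
by apply: finite_image; apply: finite_setX => //; apply: finite_setX.
Qed.

Lemma perm_mset1D (T : choiceType) (x : T) (k : {mset T}) :
  perm_eq (x +` k) (x :: k).
Proof.
by apply/allP => a _ /=; rewrite !count_mem_mset mset1DE (eq_sym a).
Qed.

Lemma mset_split (T : choiceType) (x : T) (k : {mset T}) :
  x \in k -> k = x +` (k `\ x).
Proof.
move=> xk; apply/msetP => a; rewrite mset1DE msetB1E.
case: eqP => [->|_]; last by rewrite subn0.
by rewrite subnKC // mset_gt0.
Qed.

Lemma size_mset_eq0 (T : choiceType) (k : {mset T}) : size k = 0 -> k = mset0.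
Proof.
move=> /size0nil k0; apply/msetP => a.
by rewrite -count_mem_mset k0 mset0E.
Qed.

Lemma finite_mset (T : choiceType) (A : set T) (n : nat) : finite_set A ->
  finite_set [set k : {mset T} | size k = n /\ forall x, x \in k -> A x].
Proof.
move=> fA; elim: n => [|n IH].
  apply: (@sub_finite_set _ _ [set mset0]); last exact: finite_set1.
  by move=> k [/size_mset_eq0 -> _].
apply: sub_finite_set (finite_image2 (fun x (k : {mset T}) => x +` k) fA IH).
move=> k [sk Ak].
have [x xk] : exists x, x \in k.
  by case E: (enum_mset k) sk => [|x s] // _; exists x; rewrite /in_mem /= E mem_head.
have Ek := mset_split xk.
exists x; first exact: Ak.
exists (k `\ x)%mset; last by rewrite -Ek.
split; last by move=> y yk; apply: Ak; rewrite Ek in_mset1D yk orbT.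
by have := perm_size (perm_mset1D x (k `\ x)%mset); rewrite -Ek sk => -[].
Qed.

Lemma deg_le_total (G : symmetry) (k : node G) x :
  x \in k -> deg x <= total_deg k.
Proof.
move=> /mset_split ->; rewrite /total_deg (perm_big _ (perm_mset1D _ _)).
by rewrite big_cons leq_addr.
Qed.

Lemma finite_inv_nodes_upto (G : symmetry) (nu D : nat) :
  finite_set (inv_nodes_upto G nu D).
Proof.
apply: bigcup_finite => [|i _].
  apply: (@sub_finite_set _ _ `I_nu.+1); last exact: finite_II.
  by move=> i /= /andP[].
apply: sub_finite_set (finite_mset i (finite_index G D)) => k [_ kD sk].
by split=> // x /deg_le_total xk; exact: leq_trans xk kD.
Qed.

Lemma insert_finite (G : symmetry) (g g' : set (node G)) k :
  insert g k g' -> finite_set g -> finite_set g'.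
Proof.
elim=> {g k g'} // [g k k1 k2 _ _ _ _ fg|*]; last by auto.
by rewrite finite_setU; split => //; exact: finite_set1.
Qed.

Lemma finite_final_graph (G : symmetry) (nu D : nat) (g : set (node G)) :
  final_graph nu D g -> finite_set g.
Proof.
move=> [s [_ _ _ ins]].
have : finite_set (initial_graph G D) by apply: finite_image; exact: finite_index.
by elim: ins => // ? ? ? ? ? /insert_finite H _ IH /H; exact: IH.
Qed.

Lemma finite_aux_nodes (G : symmetry) (nu D : nat) (g : set (node G)) :
  final_graph nu D g -> finite_set (aux_nodes nu D g).
Proof. by move=> /finite_final_graph; apply: sub_finite_set => k []. Qed.

Lemma finite_all_nodes (G : symmetry) (nu D : nat) (g : set (node G)) :
  final_graph nu D g -> finite_set (all_nodes nu D g).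
Proof.
move=> fg; rewrite finite_setU; split; first exact: finite_aux_nodes fg.
exact: finite_inv_nodes_upto.
Qed.

Lemma total_degD (G : symmetry) x (k : node G) :
  total_deg (x +` k) = deg x + total_deg k.
Proof. by rewrite /total_deg (perm_big _ (perm_mset1D _ _)) big_cons. Qed.

Lemma mset1_neq0 (T : choiceType) (x : T) : [mset x] <> mset0.
Proof. by move=> /msetP /(_ x); rewrite msetnxx mset0E. Qed.

Lemma insert_total (G : symmetry) (D : nat) (g : set (node G)) (k : node G) :
  (initial_graph G D `<=` g)%classic -> 0 < size k -> total_deg k <= D ->
  exists g', [/\ insert g k g', (g `<=` g')%classic & g' k].
Proof.
elim: (size k) {-2}k (erefl (size k)) g => [|n IH] {}k sk g ig k0 kD.
  by rewrite sk in k0.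
have [gk|ngk] := pselect (g k).
  by exists g; split => //; exact: insert_present.
have [[k1 [k2 [dk gk1 gk2]]]|nd] :=
    pselect (exists k1 k2, [/\ decomposes k k1 k2, g k1 & g k2]).
  exists (k |` g)%classic; split; [exact: insert_decomposable dk gk1 gk2| |].
    by move=> x gx; right.
  by left.
have [x xk xmax] : exists2 x, x \in k & forall y, y \in k -> deg y <= deg x.
  have : exists m, has (fun x => deg x == m) k.
    case E: (enum_mset k) sk => [|x s] // _.
    by exists (deg x); rewrite /= eqxx.
  move=> ex; case: (ex_maxnP ex (m := D)) => [m /hasP[x xk /eqP <-]|].
    exact: leq_trans (deg_le_total xk) kD.
  move=> m /hasP[x xk /eqP <-] mx; exists x => // y yk.
  by apply: mx; apply/hasP; exists y.
have Ek := mset_split xk.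
set k' := (k `\ x)%mset in Ek.
have sk' : size k' = n.
  by have := perm_size (perm_mset1D x k'); rewrite -Ek sk => -[].
have gx : g [mset x].
  by apply: ig; exists x => //=; exact: leq_trans (deg_le_total xk) kD.
have k'0 : k' <> mset0.
  move=> k'0; apply: ngk; rewrite Ek k'0 (_ : x +` mset0 = [mset x]) //.
  by apply/msetP => a; rewrite !msetE2 mset0E addn0.
have n0 : 0 < size k' by rewrite lt0n; apply/eqP => /size_mset_eq0.
have k'D : total_deg k' <= D.
  by apply: leq_trans kD; rewrite Ek total_degD leq_addl.
have [g' [ins gg' g'k']] := IH k' sk' g ig n0 k'D.
have dk : decomposes k [mset x] k' by split=> //; exact: mset1_neq0.
have rec g'' : insert g' k g'' -> insert g k g''.
  apply: (insert_recursive ngk _ dk xmax ins).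
  by move=> k1 k2 dk12 [gk1 gk2]; apply: nd; exists k1, k2.
have [g'k|ng'k] := pselect (g' k).
  by exists g'; split => //; apply: rec; exact: insert_present.
exists (k |` g')%classic; split.
- by apply: rec; apply: insert_decomposable dk _ g'k' => //; exact: gg'.
- by move=> y /gg' ?; right.
- by left.
Qed.

(* Statements quantified over the final graphs are therefore not vacuous. *)
Lemma exists_final_graph (G : symmetry) (nu D : nat) :
  exists g : set (node G), final_graph nu D g.
Proof.
pose r (k1 k2 : node G) := size k1 <= size k2.
pose s := sort r (fset_set (inv_nodes_upto G nu D)).
have rtot : total r by move=> a b; exact: leq_total.
have sE : [set` s] = inv_nodes_upto G nu D.
  apply/seteqP; split => k /=.
    by rewrite mem_sort in_fset_set ?inE //; exact: finite_inv_nodes_upto.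
  by move=> ?; rewrite mem_sort in_fset_set ?inE //; exact: finite_inv_nodes_upto.
have [g ins] : exists g, insert_all (initial_graph G D) s g.
  have : forall k : node G, k \in s -> 0 < size k /\ total_deg k <= D.
    move=> k ks; have : [set` s] k by [].
    by rewrite sE => -[i _ [/and3P[? _ _] ? _]].
  have : (initial_graph G D `<=` initial_graph G D)%classic by [].
  move: {2 3}(initial_graph G D) => g0.
  elim: s {sE} g0 => [|k s IH] g ig ks.
    by exists g; exact: insert_all_nil.
  have [k0 kD] := ks k (mem_head _ _).
  have [g' [ins gg' _]] := insert_total ig k0 kD.
  have [||g'' ins'] := IH g'.
  - exact: subset_trans ig gg'.
  - by move=> l ls; apply: ks; rewrite inE ls orbT.
  by exists g''; exact: insert_all_cons ins ins'.
exists g, s; split => //; first by rewrite sort_uniq fset_uniq.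
by rewrite sorted_map; exact: sort_sorted rtot _.
Qed.

End wellposed.

(* Main.v *)
(* For SO(2) and O(3), every auxiliary node is a proper sub-multiset of an
   invariant node, hence has order at most [nu - 1] and degree at most D: with
   one-particle indices of dimension d there are O(D^(d (nu - 1))) such nodes,
   against at least c D^(d nu - 1) invariant nodes of order nu.

   For T, the auxiliary nodes are the multisets of 2 to [nu - 1] integers of the
   same sign with sum at most D/2 in absolute value.  Indeed an invariant node
   without zeros splits into its positive part P and its negative part Q; if both
   have at least two elements, they are already present, having been inserted
   with the invariant nodes of lower order [P, -sum P] and [Q, -sum Q].  If Q is
   a singleton, [P, Q] can only be decomposed as P and Q, which forces P into the
   graph.  So auxiliary nodes are counted by partitions, and invariant nodes by
   pairs of partitions of the same integer.  The recurrence
   pi(p + 1, n + p + 1) = pi(p, n + p) + pi(p + 1, n) gives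
   pi(p, n) ~ n^(p - 1) / (p! (p - 1)!), and with N = D/2 the two numbers are
   equivalent to 2 N^(nu - 1) / (nu - 1)!^2 and, by Vandermonde's identity,
   binom(2 nu - 2, nu - 1) N^(nu - 1) / (nu! (nu - 1)!). *)
Require Import Defs.
From HB Require Import structures.
From mathcomp Require Import all_boot all_order all_algebra.
From mathcomp Require Import finmap multiset.
From mathcomp Require Import all_classical all_reals all_analysis.
From mathcomp Require Import zify ring lra.

Set Implicit Arguments.
Unset Strict Implicit.
Unset Printing Implicit Defensive.

Import Order.TTheory GRing.Theory Num.Theory.
Import numFieldNormedType.Exports.

Local Open Scope mset_scope.
Local Open Scope classical_set_scope.
Local Open Scope ring_scope.

(** * Cardinalities and multisets *)

Section Cardinality.
Local Open Scope nat_scope.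

Lemma card_set0 (T : choiceType) : card_set (@set0 T) = 0.
Proof. by rewrite /card_set fset_set0 cardfs0. Qed.

Lemma card_set_in_image (T U : choiceType) (f : T -> U) (A : set T) :
  {in A &, injective f} -> card_set (f @` A) = card_set A.
Proof.
move=> inj_f; have fEA := inj_card_eq inj_f.
have [finA|infA] := pselect (finite_set A); last first.
  (* An injective image of an infinite set is infinite, and both cardinalities take the default
     value 0. *)
  rewrite /card_set /fset_set; case: pselect => // h1; last by case: pselect.
  by case: infA; rewrite -(eq_finite_set fEA).
rewrite /card_set fset_set_image // card_in_imfset // => x y.
by rewrite !in_fset_set //; exact: inj_f.
Qed.

Lemma leq_card_set (T : choiceType) (A B : set T) :
  finite_set B -> A `<=` B -> card_set A <= card_set B.
Proof.
move=> finB AB; apply: fsubset_leq_card.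
by rewrite -fset_set_sub //; exact: sub_finite_set finB.
Qed.

Lemma leq_card_set_in (T U : choiceType) (f : T -> U) (A : set T) (B : set U) :
  finite_set B -> {in A &, injective f} -> f @` A `<=` B ->
  card_set A <= card_set B.
Proof. by move=> finB /card_set_in_image <-; exact: leq_card_set. Qed.

Lemma card_setU (T : choiceType) (A B : set T) :
  finite_set A -> finite_set B -> [disjoint A & B] ->
  card_set (A `|` B) = card_set A + card_set B.
Proof.
move=> finA finB /disj_setPS dAB; rewrite /card_set fset_setU // cardfsU.
rewrite -fset_setI // (_ : A `&` B = set0) ?fset_set0 ?cardfs0 ?subn0 //.
by apply/seteqP; split.
Qed.

Lemma card_setX (T U : choiceType) (A : set T) (B : set U) :
  finite_set A -> finite_set B -> card_set (A `*` B) = card_set A * card_set B.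
Proof.
move=> finA finB; rewrite /card_set fset_setX //.
rewrite -(size_allpairs pair); apply/perm_size/uniq_perm => //.
  by apply: allpairs_uniq => // -[? ?] [? ?] _ _ [-> ->].
move=> [x y]; rewrite in_fsetM /=.
by apply/andP/allpairsP => [[xA yB]|[[a b] [aA bB [-> ->]]]]; first exists (x, y).
Qed.

(** Applied several times in a row, this turns a cardinality into nested sums over the order, the
    degree and the numbers of elements of each sign. *)
Lemma card_set_fibers (T : choiceType) (A : set T) (f : T -> nat) (n : nat) :
  finite_set A -> (forall x, A x -> f x < n) ->
  card_set A = \sum_(0 <= i < n) card_set [set x | A x /\ f x = i].
Proof.
elim: n A => [|n IHn] A finA ltfn.
  rewrite big_geq // (_ : A = set0) ?card_set0 //.
  by apply/seteqP; split => // x /ltfn.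
have fin (P : set T) : finite_set [set x | A x /\ P x].
  by apply: sub_finite_set finA => x [].
rewrite big_nat_recr //=.
rewrite [A in LHS](_ : A = [set x | A x /\ f x < n] `|` [set x | A x /\ f x = n]);
  last first.
  apply/seteqP; split => x /=; last by case=> -[].
  by move=> Ax; have := ltfn x Ax; rewrite ltnS leq_eqVlt => /orP[/eqP|]; [right|left].
rewrite card_setU //; last first.
  by apply/disj_setPS => x /= [[_ +] [_ xn]]; rewrite xn ltnn.
congr (_ + _); rewrite IHn //; last by move=> x [].
apply: eq_big_nat => i /andP[_ ilt]; congr card_set.
by apply/seteqP; split => x /= [] => [[Ax _] //|Ax ->].
Qed.

Lemma card_set_finType (T : finType) (P : pred T) :
  card_set [set x | P x] = #|P|.
Proof.
rewrite /card_set -card_finset; congr (#|` _|).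
apply/fsetP => x; rewrite in_fset_set; last exact: finite_finset.
by apply/idP/imfsetP => [/set_mem Px|[y Py ->]]; [exists x|exact/mem_set].
Qed.

Lemma card_set_II (n : nat) : card_set `I_n = n.
Proof. exact/card_fset_set/card_eqxx. Qed.
End Cardinality.

Section Multisets.
Local Open Scope nat_scope.
Variable T : choiceType.
Implicit Types k : {mset T}.

Lemma perm_msetD k1 k2 : perm_eq (k1 `+` k2)%mset (k1 ++ k2).
Proof.
apply/allP => a _ /=.
by rewrite count_cat !count_mem_mset msetE2.
Qed.

Lemma size_msetD k1 k2 : size (k1 `+` k2)%mset = size k1 + size k2.
Proof. by rewrite (perm_size (perm_msetD _ _)) size_cat. Qed.

Lemma big_msetD (R : Type) (idx : R) (op : Monoid.com_law idx) (F : T -> R) k1 k2 :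
  \big[op/idx]_(x <- (k1 `+` k2)%mset) F x =
  op (\big[op/idx]_(x <- k1) F x) (\big[op/idx]_(x <- k2) F x).
Proof. by rewrite (perm_big _ (perm_msetD _ _)) big_cat. Qed.

Lemma big_mset1 (R : Type) (idx : R) (op : Monoid.com_law idx) (F : T -> R) x :
  \big[op/idx]_(y <- [mset x]%mset) F y = F x.
Proof. by rewrite enum_msetn /= big_seq1. Qed.

Lemma size_seq_mset (s : seq T) : size (seq_mset s) = size s.
Proof. exact/perm_size/perm_eq_seq_mset. Qed.

Lemma big_seq_mset (R : Type) (idx : R) (op : Monoid.com_law idx) (F : T -> R) s :
  \big[op/idx]_(x <- seq_mset s) F x = \big[op/idx]_(x <- s) F x.
Proof. exact/perm_big/perm_eq_seq_mset. Qed.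

Lemma mem_seq_mset (s : seq T) : seq_mset s =i s.
Proof. exact/perm_mem/perm_eq_seq_mset. Qed.

Lemma size_mset1D x k : size (x +` k)%mset = (size k).+1.
Proof. by rewrite size_msetD enum_msetn. Qed.

(** A nonempty multiset arises by adding one element to a smaller one, so each unit of size costs at
    most one factor [card_set A]. The orderings counted in excess only affect constants. *)
Lemma card_mset_leq (A : set T) (n : nat) : finite_set A ->
  card_set [set k : {mset T} | size k = n /\ forall x, x \in k -> A x]
    <= card_set A ^ n.
Proof.
move=> finA; elim: n => [|n IHn].
  rewrite expn0; apply: leq_trans (_ : card_set [set (mset0 : {mset T})] <= 1).
    apply: leq_card_set; first exact: finite_set1.
    by move=> k [/eqP]; rewrite size_mset_eq0 => /eqP -> _.
  by rewrite /card_set fset_set1 cardfs1.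
pose B := [set k : {mset T} | size k = n /\ forall x, x \in k -> A x].
rewrite -/B in IHn.
have finB : finite_set B by exact: finite_mset.
rewrite expnS; apply: leq_trans (leq_mul (leqnn _) IHn).
rewrite -card_setX //.
apply: leq_trans (_ : card_set [set (p.1 +` p.2)%mset | p in A `*` B] <= _).
  apply: leq_card_set; first exact/finite_image/finite_setX.
  move=> k [sk kA].
  have [k0|[x xk]] := mset_0Vmem k; first by rewrite k0 size_mset0 in sk.
  exists (x, (k `\ x)%mset) => /=; last by rewrite msetB1K.
  have := mset_split xk => Ek; split; first exact: kA.
  split; last by move=> y yk; apply: kA; rewrite Ek in_mset1D yk orbT.
  by move: sk; rewrite {1}Ek size_mset1D => -[].
rewrite /card_set fset_set_image ?leq_imfset_card //; first exact: finite_setX.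
Qed.

Lemma msetD1_inj (x : T) k k' : (x +` k)%mset = (x +` k')%mset -> k = k'.
Proof. by move=> /(congr1 (fun k => (k `\ x)%mset)); rewrite !msetD1K. Qed.

Lemma mset_filterC (a : pred T) k :
  k = (seq_mset [seq x <- k | a x] `+` seq_mset [seq x <- k | ~~ a x])%mset.
Proof.
apply/msetP => x; rewrite msetE2 !mset_seqE -count_mem_mset -count_cat.
by have /permP -> := permEl (perm_filterC a k).
Qed.

Lemma mset_size1 k : size k = 1 -> exists x, k = [mset x]%mset.
Proof.
move=> k1; case: (mset_0Vmem k) => [k0|[x xk]]; first by rewrite k0 size_mset0 in k1.
exists x; have kE := mset_split xk; rewrite kE; move: k1; rewrite kE size_mset1D => -[].
by move/eqP; rewrite size_mset_eq0 => /eqP; rewrite -kE => ->; rewrite msetD0.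
Qed.
End Multisets.

(** * Insertion *)

Section Insertion.
Local Open Scope nat_scope.
Variable G : symmetry.
Implicit Types (g : set (node G)) (k : node G) (s : seq (node G)).

Lemma total_deg_msetD k1 k2 :
  total_deg (k1 `+` k2)%mset = total_deg k1 + total_deg k2.
Proof. exact: big_msetD. Qed.

(** Inversion in a form that gives [g'] by equations and leaves [g] and [k] untouched, whatever
    terms they are. *)
Lemma insert_inv g k g' :
  insert g k g' ->
  [\/ g' = g,
      exists k1 k2, [/\ decomposes k k1 k2, g k1, g k2 & g' = (k |` g)%classic]
    | exists g1 x k', [/\ ~ g k /\
          (forall k1 k2, decomposes k k1 k2 -> ~ (g k1 /\ g k2)),
        decomposes k [mset x]%mset k', forall y, y \in k -> (deg y <= deg x)%N,
        insert g k' g1 & insert g1 k g']].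
Proof.
case=> {g k g'} [g k gk|g k k1 k2 ngk dec gk1 gk2|g g1 g2 k x k' ngk ndec dec mx i1 i2].
- by constructor 1.
- by constructor 2; exists k1, k2.
- by constructor 3; exists g1, x, k'.
Qed.

Lemma insert_subset g k g' : insert g k g' -> g `<=` g'.
Proof.
elim=> {g k g'} [g k _ x //|g k k1 k2 _ _ _ _ x gx|]; first by right.
by move=> g g' g'' k x k' _ _ _ _ _ gg' _ g'g''; exact: subset_trans gg' g'g''.
Qed.

Lemma insert_in g k g' : insert g k g' -> g' k.
Proof. by elim=> {g k g'} // g k *; left. Qed.

(** Each recursive call removes one element, so the nodes inserted on the way to [k] are smaller in
    order and no larger in degree. *)
Lemma insert_new g k g' : insert g k g' -> forall x, g' x ->
  [\/ g x, x = k | size x < size k /\ total_deg x <= total_deg k].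
Proof.
elim=> {g k g'} [g k gk x gx|g k k1 k2 _ _ _ _ x|]; first by constructor 1.
  by case=> [->|gx]; [constructor 2|constructor 1].
move=> g g' g'' k y k' _ _ [_ _ kE] _ _ IH1 _ IH2 x /IH2 []; last 2 first.
- by constructor 2.
- by constructor 3.
have sk : size k = (size k').+1 by rewrite kE size_mset1D.
have dk : total_deg k' <= total_deg k by rewrite kE total_deg_msetD leq_addl.
case/IH1 => [|->|[sx dx]]; [by constructor 1|by constructor 3; rewrite sk|].
by constructor 3; rewrite sk ltnW //; split => //; exact: leq_trans dk.
Qed.

Lemma insert_all_new g s g' (nu D : nat) : insert_all g s g' ->
  (forall k, k \in s -> size k <= nu /\ total_deg k <= D) ->
  forall x, g' x -> [\/ g x, x \in s | size x < nu /\ total_deg x <= D].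
Proof.
elim=> {g s g'} [g _ x gx|g g' g'' k s ins _ IH sD x]; first by constructor 1.
have [k_nu kD] := sD k (mem_head _ _).
move=> /IH [k' k's||xs|]; last by constructor 3.
- by apply: sD; rewrite inE k's orbT.
- case/(insert_new ins) => [|->|[sx dx]]; first by constructor 1.
    by constructor 2; rewrite mem_head.
  by constructor 3; split; [exact: leq_trans sx k_nu|exact: leq_trans dx kD].
- by constructor 2; rewrite inE xs orbT.
Qed.

Lemma inv_nodes_uptoP (nu D : nat) k :
  inv_nodes_upto G nu D k <->
  [/\ invariant_node k, total_deg k <= D & size k <= nu].
Proof.
split=> [[i /= /andP[_ i_nu] [kI kD ki]]|[kI kD k_nu]].
  by split => //; rewrite ki.
by exists (size k) => //=; rewrite k_nu andbT; case/and3P: kI.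
Qed.

Lemma aux_nodes_small (nu D : nat) g k : final_graph nu D g ->
  aux_nodes nu D g k -> size k < nu /\ total_deg k <= D.
Proof.
move=> [s [_ sE _ ins]] [gk k2 ninv].
have sP (x : node G) : x \in s <-> inv_nodes_upto G nu D x by rewrite -sE.
have sD (x : node G) : x \in s -> size x <= nu /\ total_deg x <= D.
  by move=> /sP/inv_nodes_uptoP[].
case: (insert_all_new ins sD gk) => //.
  by case=> x _ kE; rewrite -kE enum_msetn in k2.
by move/sP.
Qed.

(** Each of the [nu] possible orders is bounded by [card_mset_leq]. The successor keeps the base
    positive, which makes its powers monotone in the exponent. *)
Lemma card_aux_nodes_leq (nu D : nat) g : final_graph nu D g ->
  card_set (aux_nodes nu D g) <=
    nu * (card_set [set x : Defs.index G | deg x <= D]).+1 ^ nu.-1.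
Proof.
move=> fg; set I := [set x | _].
rewrite (card_set_fibers (finite_aux_nodes fg)
  (fun k kA => (aux_nodes_small fg kA).1)).
rewrite big_mkord -[X in _ <= X * _]card_ord -sum_nat_const.
apply: leq_sum => i _.
have inu : i <= nu.-1 by case: i => i /=; case: nu {g fg}.
apply: leq_trans (_ : (card_set I).+1 ^ i <= _); last exact: leq_pexp2l.
apply: leq_trans (_ : card_set I ^ i <= _); last first.
  by case: (posnP i) => [->//|i0]; rewrite leq_exp2r.
apply: leq_trans (card_mset_leq i (finite_index G D)).
apply: leq_card_set; first exact/finite_mset/finite_index.
move=> k [kA ki]; split => // x xk.
exact: leq_trans (deg_le_total xk) (aux_nodes_small fg kA).2.
Qed.
End Insertion.

(** * The groups SO(2) and O(3) *)

(** Here [r.+1] is the order and [e.+1] the dimension d of a one-particle index. Auxiliary nodes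
    lack one particle, hence exponent d r. Invariant nodes lose one dimension out of d (r + 1) to
    the condition on the sum of the m, hence exponent d r + e. The gain is D^e. *)
Lemma card_aux_nodes_mul_leq (G : symmetry) (r e c1 c2 D : nat) (g : set (node G)) :
  (0 < D)%N -> final_graph r.+1 D g ->
  (card_set [set x : Defs.index G | (deg x <= D)%N] <= c1 * D ^ e.+1)%N ->
  (D ^ (e.+1 * r + e) <= c2 * card_set (inv_nodes G r.+1 D))%N ->
  (card_set (aux_nodes r.+1 D g) * D ^ e <=
     (r.+1 * c1.+1 ^ r * c2) * card_set (all_nodes r.+1 D g))%N.
Proof.
move=> D0 fg index_le inv_ge.
have inv_all : (card_set (inv_nodes G r.+1 D) <= card_set (all_nodes r.+1 D g))%N.
  apply: leq_card_set; first exact: finite_all_nodes.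
  by move=> k kI; right; exists r.+1 => //=; rewrite ltnS leqnn.
rewrite -mulnA; apply: (@leq_trans (r.+1 * c1.+1 ^ r * D ^ (e.+1 * r + e))).
  rewrite expnD mulnA leq_mul2r; apply/orP; right.
  apply: leq_trans (card_aux_nodes_leq fg) _.
  rewrite -mulnA leq_mul2l /= [X in (_ <= _ * X)%N]expnM -expnMn.
  case: (posnP r) => [->//|r0]; rewrite leq_exp2r //.
  apply: leq_ltn_trans index_le _.
  by rewrite mulSn -[X in (X < _)%N]add0n ltn_add2r expn_gt0 D0.
rewrite leq_mul2l; apply/orP; right; apply: leq_trans inv_ge _.
by rewrite leq_mul2l inv_all orbT.
Qed.

Lemma aux_ratio_bigO (R : realType) (G : symmetry) (r e c1 c2 D0 : nat) :
  (forall D, (0 < D)%N ->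
    (card_set [set x : Defs.index G | (deg x <= D)%N] <= c1 * D ^ e.+1)%N) ->
  (forall D, (D0 <= D)%N ->
    (D ^ (e.+1 * r + e) <= c2 * card_set (inv_nodes G r.+1 D))%N) ->
  forall g : nat -> set (node G),
    (forall D, (0 < D)%N -> final_graph r.+1 D (g D)) ->
    (fun D : nat => aux_ratio R r.+1 D (g D)) =O_\oo
      (fun D : nat => (D%:R ^+ e)^-1 : R).
Proof.
move=> index_le inv_ge g fg; apply/eqOP; near=> k; near=> D.
have D_gt0 : (0 < D)%N by near: D; exact: nbhs_infty_ge.
have D_ge : (D0 <= D)%N by near: D; exact: nbhs_infty_ge.
have := card_aux_nodes_mul_leq D_gt0 (fg D D_gt0) (index_le D D_gt0) (inv_ge D D_ge).
set C := (r.+1 * _ * c2)%N => le_AV.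
have C_le_k : C%:R <= k by near: k; apply: nbhs_pinfty_ge; rewrite realn.
rewrite /aux_ratio; move: le_AV.
set A := card_set (aux_nodes _ _ _); set V := card_set (all_nodes _ _ _) => le_AV.
(* If there are no nodes, the quotient is 0 by the convention on division by 0. *)
have [->|V_gt0] := posnP V.
  by rewrite invr0 mulr0 normr0 mulr_ge0 // (le_trans _ C_le_k).
have De_gt0 : 0 < D%:R ^+ e :> R by rewrite exprn_gt0 // ltr0n.
rewrite ger0_norm ?divr_ge0 // [X in _ <= _ * X]ger0_norm ?invr_ge0 ?exprn_ge0 //.
apply: (@le_trans _ _ (C%:R / D%:R ^+ e)); last by rewrite ler_wpM2r // invr_ge0 ltW.
rewrite ler_pdivrMr ?ltr0n // mulrAC ler_pdivlMr //.
by rewrite -natrX -!natrM ler_nat.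
Unshelve. all: by end_near.
Qed.

(** Since |m| <= D, the shifted number m + D is a natural number at most 2 D, and (D + 1)(2 D + 1)
    <= (2 D)(3 D). *)
Lemma card_index_SO2 (D : nat) : (0 < D)%N ->
  (card_set [set x : Defs.index SO2 | (deg x <= D)%N] <= 6 * D ^ 2)%N.
Proof.
move=> D_gt0.
apply: (@leq_trans (card_set (`I_D.+1 `*` `I_(D * 2).+1))).
  apply: (@leq_card_set_in (Defs.index SO2) (nat * nat)%type
    (fun x : nat * int => (x.1, absz (x.2 + D%:Z)))).
  - exact: finite_setX.
  - by move=> [n m] [n' m']; rewrite !inE /= => h h' [-> mE]; congr pair; lia.
  - by move=> _ [[n m] /= h <-]; split => /=; lia.
rewrite card_setX // !card_set_II; nia.
Qed.

(** The same shift works because |m| <= l <= D, and (D + 1)^2 (2 D + 1) <= (2 D)^2 (3 D). *)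
Lemma card_index_O3 (D : nat) : (0 < D)%N ->
  (card_set [set x : Defs.index O3 | (deg x <= D)%N] <= 12 * D ^ 3)%N.
Proof.
move=> D_gt0.
apply: (@leq_trans (card_set (`I_D.+1 `*` `I_D.+1 `*` `I_(D * 2).+1))).
  apply: (@leq_card_set_in (Defs.index O3) (nat * nat * nat)%type
    (fun x : Defs.index O3 => ((val x).1, absz ((val x).2 + D%:Z)))).
  - by apply: finite_setX => //; exact: finite_setX.
  - move=> [[[n l] m] /= h] [[[n' l'] m'] /= h']; rewrite !inE /= => d d' [nE lE mE].
    apply/val_inj => /=; congr (_, _, _) => //; lia.
  - by move=> _ [[[[n l] m] /= h] /= d <-]; split => /=; [split => /=|]; lia.
rewrite !card_setX //; last exact: finite_setX.
rewrite !card_set_II.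
have -> : (12 * D ^ 3 = (D + D) * (D + D) * (3 * D))%N by rewrite !expnS expn0; ring.
by apply: leq_mul; [apply: leq_mul|]; lia.
Qed.

(** A strictly increasing key leaves only one way to enumerate the multiset, so no tuple is lost
    when passing to unordered nodes. *)
Lemma seq_mset_inj_sorted (T : choiceType) (key : T -> nat) (n : nat)
    (F F' : 'I_n -> T) :
  {homo F : i j / (i < j)%N >-> (key i < key j)%N} ->
  {homo F' : i j / (i < j)%N >-> (key i < key j)%N} ->
  seq_mset [seq F t | t <- enum 'I_n] = seq_mset [seq F' t | t <- enum 'I_n] ->
  F =1 F'.
Proof.
have srt (H : 'I_n -> T) : {homo H : i j / (i < j)%N >-> (key i < key j)%N} ->
    sorted (relpre key ltn) [seq H t | t <- enum 'I_n].
  move=> H_homo; rewrite sorted_map.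
  apply: (@sub_sorted _ (relpre val ltn)) => [i j|]; first exact: H_homo.
  by rewrite -sorted_map val_enum_ord iota_ltn_sorted.
move=> /srt F_srt /srt F'_srt /eq_seq_msetP/perm_mem FF'.
have /eq_in_map eqFF' : [seq F t | t <- enum 'I_n] = [seq F' t | t <- enum 'I_n].
  apply: irr_sorted_eq F_srt F'_srt FF' => [x y z /=|x /=].
    exact: ltn_trans.
  by rewrite ltnn.
by move=> t; apply: eqFF'; rewrite mem_enum.
Qed.

Lemma big_ord_lift_max (V : nmodType) (r : nat) (F : 'I_r.+1 -> V) :
  \sum_t F t = \sum_(i < r) F (lift ord_max i) + F ord_max.
Proof.
rewrite big_ord_recr; congr (_ + _); apply: eq_bigr => i _; congr F.
by apply: ord_inj; rewrite lift_max.
Qed.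

Lemma big_seq_mset_ord (T : choiceType) (R : Type) (idx : R)
    (op : Monoid.com_law idx) (n : nat) (H : 'I_n -> T) (F : T -> R) :
  \big[op/idx]_(x <- seq_mset [seq H t | t <- enum 'I_n]) F x =
  \big[op/idx]_t F (H t).
Proof. by rewrite big_seq_mset big_map big_enum. Qed.

(** * Lower bounds for the number of invariant nodes of SO(2) and O(3) *)

Section LowerBound.
Variables r M : nat.
Implicit Types (n lam : {ffun 'I_r.+1 -> 'I_M}) (a : {ffun 'I_r -> 'I_M}).

(* Completes the magnetic numbers [a] by the one that makes their sum vanish. *)
Definition balanced a (t : 'I_r.+1) : int :=
  if unlift ord_max t is Some i then (a i : nat)%:Z
  else - \sum_i (a i : nat)%:Z.

Lemma balanced_lift a i : balanced a (lift ord_max i) = (a i : nat)%:Z.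
Proof. by rewrite /balanced liftK. Qed.

Lemma balanced_max a : balanced a ord_max = - \sum_i (a i : nat)%:Z.
Proof. by rewrite /balanced unlift_none. Qed.

Lemma sum_balanced a : \sum_t balanced a t = 0.
Proof.
rewrite big_ord_lift_max balanced_max; under eq_bigr do rewrite balanced_lift.
by rewrite subrr.
Qed.

Lemma absz_balanced_max a : (absz (balanced a ord_max) <= r * M)%N.
Proof.
rewrite balanced_max abszN -(big_morph _ PoszD (erefl _)) absz_nat.
rewrite -[X in (_ <= X * _)%N]card_ord -sum_nat_const.
by apply: leq_sum => i _; exact: ltnW.
Qed.

Lemma balanced_inj a a' : balanced a =1 balanced a' -> a = a'.
Proof.
move=> eq_a; apply/ffunP => i; have := eq_a (lift ord_max i).
by rewrite !balanced_lift => -[/val_inj].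
Qed.

(* The offset [t * M] separates the particles: the values of [spread n] are
   increasing, so that a tuple can be recovered from the multiset of its
   entries. *)
Definition spread n (t : 'I_r.+1) : nat := (t * M + n t)%N.

Lemma spread_lt n : {homo spread n : i j / (i < j)%N >-> (i < j)%N}.
Proof.
move=> i j ij; rewrite /spread; apply: (@leq_trans (i.+1 * M)).
  by rewrite mulSnr -addnS leq_add2l.
by apply: leq_trans (leq_addr _ _); rewrite leq_mul2r ij orbT.
Qed.

Lemma spread_leq n t : (spread n t <= r.+1 * M)%N.
Proof.
apply: (@leq_trans (t.+1 * M)).
  by rewrite mulSnr leq_add2l ltnW.
by rewrite leq_mul2r; apply/orP; right; case: t.
Qed.

Lemma spread_inj n n' : spread n =1 spread n' -> n = n'.
Proof.
move=> eq_n; apply/ffunP => t; apply/val_inj.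
by have /eqP := eq_n t; rewrite /spread eqn_add2l => /eqP.
Qed.

Definition entry_SO2 n a (t : 'I_r.+1) : Defs.index SO2 :=
  (spread n t, balanced a t).

Lemma deg_entry_SO2 n a t : (deg (entry_SO2 n a t) <= (r.*2 + 4) * M)%N.
Proof.
rewrite /=; apply: (@leq_trans (r.+1 * M + r.+1 * M)); last first.
  by rewrite -mulnDl leq_mul2r; apply/orP; right; lia.
apply: leq_add; first exact: spread_leq.
case: (unliftP ord_max t) => [i ->|->].
  by rewrite balanced_lift absz_nat mulSn ltnW // ltn_addr.
by apply: leq_trans (absz_balanced_max a) _; rewrite leq_mul2r leqnSn orbT.
Qed.

(* The last orbital number is at least [r * M], to dominate the last magnetic
   number, and corrects the parity of the sum. *)
Definition orbital lam (t : 'I_r.+1) : nat :=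
  if unlift ord_max t is Some i then (M + lam t)%N
  else (r * M + (lam t).*2
        + odd (\sum_(i < r) (M + lam (lift ord_max i)) + r * M))%N.

Lemma orbital_lift lam i :
  orbital lam (lift ord_max i) = (M + lam (lift ord_max i))%N.
Proof. by rewrite /orbital liftK. Qed.

Lemma orbital_max lam : orbital lam ord_max = (r * M + (lam ord_max).*2
  + odd (\sum_(i < r) (M + lam (lift ord_max i)) + r * M))%N.
Proof. by rewrite /orbital unlift_none. Qed.

(** The parity correction in the last entry depends only on the other entries. Once these agree it
    cancels, and doubling is injective. *)
Lemma orbital_inj lam lam' : orbital lam =1 orbital lam' -> lam = lam'.
Proof.
move=> eq_l.
have eq_lift i : lam (lift ord_max i) = lam' (lift ord_max i).
  apply/val_inj; have /eqP := eq_l (lift ord_max i).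
  by rewrite !orbital_lift eqn_add2l => /eqP.
apply/ffunP => t; case: (unliftP ord_max t) => [i ->//|->]; apply/val_inj.
have := eq_l ord_max; rewrite !orbital_max.
under [in X in _ = X]eq_bigr do rewrite -eq_lift.
by move/eqP; rewrite eqn_add2r eqn_add2l => /eqP /double_inj.
Qed.

Lemma orbital_leq lam t : (0 < M -> orbital lam t <= (r + 3) * M)%N.
Proof.
move=> M_gt0; case: (unliftP ord_max t) => [i ->|->].
  rewrite orbital_lift; have := ltn_ord (lam (lift ord_max i)); nia.
rewrite orbital_max; case: (odd _) => /=; have := ltn_ord (lam ord_max); nia.
Qed.

Lemma sum_orbital_even lam : odd (\sum_t orbital lam t)%N = false.
Proof.
have -> : (\sum_t orbital lam t = \sum_i orbital lam (lift ord_max i)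
    + orbital lam ord_max)%N := big_ord_lift_max (orbital lam).
rewrite orbital_max; under eq_bigr do rewrite orbital_lift.
set s := (\sum_(i < r) _)%N.
by rewrite !oddD odd_double oddb; case: (odd s); case: (odd (r * M)).
Qed.

Lemma balanced_leq_orbital lam a t : (absz (balanced a t) <= orbital lam t)%N.
Proof.
case: (unliftP ord_max t) => [i ->|->].
  by rewrite balanced_lift orbital_lift absz_nat ltnW // ltn_addr.
by rewrite orbital_max (leq_trans (absz_balanced_max a)) // -addnA leq_addr.
Qed.

Definition entry_O3 n lam a (t : 'I_r.+1) : Defs.index O3 :=
  exist _ (spread n t, orbital lam t, balanced a t)
    (balanced_leq_orbital lam a t).

(** The radial number is at most (r + 1) M and the orbital one at most (r + 3) M. The same bound is
    used for SO(2), so that both groups share the constant (r + 1)(2 r + 4). *)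
Lemma deg_entry_O3 n lam a t : (0 < M)%N ->
  (deg (entry_O3 n lam a t) <= (r.*2 + 4) * M)%N.
Proof.
move=> M_gt0; rewrite /=; apply: (@leq_trans (r.+1 * M + (r + 3) * M)).
  by rewrite leq_add ?spread_leq ?orbital_leq.
by rewrite -mulnDl leq_mul2r; apply/orP; right; lia.
Qed.

Lemma total_deg_leq (G : symmetry) (F : 'I_r.+1 -> Defs.index G) (B : nat) :
  (forall t, deg (F t) <= B)%N ->
  (total_deg (seq_mset [seq F t | t <- enum 'I_r.+1]) <= r.+1 * B)%N.
Proof.
move=> FB; rewrite /total_deg big_seq_mset_ord.
rewrite -[X in (_ <= X * _)%N]card_ord -sum_nat_const.
by apply: leq_sum.
Qed.

(** The r + 1 radial numbers and the first r magnetic numbers each range freely over M values; the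
    last magnetic number is forced. *)
Lemma expn_leq_card_inv_SO2 (D : nat) :
  (r.+1 * ((r.*2 + 4) * M) <= D)%N ->
  (M ^ (2 * r + 1) <= card_set (inv_nodes SO2 r.+1 D))%N.
Proof.
move=> MD; pose X := ({ffun 'I_r.+1 -> 'I_M} * {ffun 'I_r -> 'I_M})%type.
have <- : card_set [set x : X | predT x] = (M ^ (2 * r + 1))%N.
  rewrite card_set_finType card_prod !card_ffun !card_ord -expnD; congr expn.
  by lia.
pose f (x : X) : node SO2 :=
  seq_mset [seq entry_SO2 x.1 x.2 t | t <- enum 'I_r.+1].
apply: (@leq_card_set_in _ _ f).
- apply: sub_finite_set (finite_inv_nodes_upto SO2 r.+1 D).
  by move=> k [kI kD kr]; apply/inv_nodes_uptoP; rewrite kr.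
- move=> [n a] [n' a'] _ _ /(seq_mset_inj_sorted (key := fst)) eq_na.
  have {}eq_na t : entry_SO2 n a t = entry_SO2 n' a' t.
    by apply: eq_na => i j; exact: spread_lt.
  congr pair; [apply: spread_inj|apply: balanced_inj] => t.
    by have [] := eq_na t.
  by have [] := eq_na t.
- move=> _ [[n a] _ <-]; split.
  + rewrite /invariant_node andbT size_seq_mset size_map size_enum_ord /=.
    by rewrite big_seq_mset_ord /= sum_balanced.
  + by apply: leq_trans (total_deg_leq _) MD => t; exact: deg_entry_SO2.
  + by rewrite size_seq_mset size_map size_enum_ord.
Qed.

(** Compared with SO(2), there are r + 1 further free parameters, the orbital numbers, whose parity
    constraint costs only a constant factor. *)
Lemma expn_leq_card_inv_O3 (D : nat) : (0 < M)%N ->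
  (r.+1 * ((r.*2 + 4) * M) <= D)%N ->
  (M ^ (3 * r + 2) <= card_set (inv_nodes O3 r.+1 D))%N.
Proof.
move=> M_gt0 MD; pose X := ({ffun 'I_r.+1 -> 'I_M} * {ffun 'I_r.+1 -> 'I_M} *
  {ffun 'I_r -> 'I_M})%type.
have <- : card_set [set x : X | predT x] = (M ^ (3 * r + 2))%N.
  rewrite card_set_finType !card_prod !card_ffun !card_ord -!expnD; congr expn.
  by lia.
pose f (x : X) : node O3 :=
  seq_mset [seq entry_O3 x.1.1 x.1.2 x.2 t | t <- enum 'I_r.+1].
apply: (@leq_card_set_in _ _ f).
- apply: sub_finite_set (finite_inv_nodes_upto O3 r.+1 D).
  by move=> k [kI kD kr]; apply/inv_nodes_uptoP; rewrite kr.
- move=> [[n l] a] [[n' l'] a'] _ _.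
  move=> /(seq_mset_inj_sorted (key := fun x : Defs.index O3 => (val x).1.1)) eq_na.
  have {}eq_na t : val (entry_O3 n l a t) = val (entry_O3 n' l' a' t).
    by congr val; apply: eq_na => i j; exact: spread_lt.
  congr (_, _, _); [apply: spread_inj|apply: orbital_inj|apply: balanced_inj] => t.
  + by have [] := eq_na t.
  + by have [] := eq_na t.
  + by have [] := eq_na t.
- move=> _ [[[n l] a] _ <-]; split.
  + rewrite /invariant_node size_seq_mset size_map size_enum_ord /=.
    by rewrite !big_seq_mset_ord /= sum_balanced sum_orbital_even.
  + by apply: leq_trans (total_deg_leq _) MD => t; exact: deg_entry_O3.
  + by rewrite size_seq_mset size_map size_enum_ord.
Qed.
End LowerBound.

(** Take M = D %/ c, which is positive and satisfies D <= 2 c M as soon as D >= c. *)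
Lemma polynomial_lower_bound (c m : nat) (K : nat -> nat) : (0 < c)%N ->
  (forall M D, 0 < M -> c * M <= D -> M ^ m <= K D)%N ->
  forall D, (c <= D -> D ^ m <= (c * 2) ^ m * K D)%N.
Proof.
move=> c_gt0 HK D cD; have M_gt0 : (0 < D %/ c)%N by rewrite divn_gt0.
apply: (@leq_trans ((c * 2 * (D %/ c)) ^ m)); last first.
  by rewrite expnMn leq_mul2l HK ?orbT // mulnC leq_divM.
case: (posnP m) => [->//|m_gt0]; rewrite leq_exp2r //.
have := divn_eq D c; have := ltn_pmod D c_gt0; nia.
Qed.

Lemma aux_ratio_SO2 (R : realType) (r : nat) (g : nat -> set (node SO2)) :
  (forall D, (0 < D)%N -> final_graph r.+1 D (g D)) ->
  (fun D : nat => aux_ratio R r.+1 D (g D)) =O_\oo (fun D : nat => D%:R^-1 : R).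
Proof.
pose c := (r.+1 * (r.*2 + 4))%N; have c_gt0 : (0 < c)%N by rewrite muln_gt0 addnS.
apply: (@aux_ratio_bigO _ _ _ 1 _ _ c card_index_SO2).
apply: polynomial_lower_bound => // M D _ MD.
by apply: expn_leq_card_inv_SO2; rewrite mulnA.
Qed.

Lemma aux_ratio_O3 (R : realType) (r : nat) (g : nat -> set (node O3)) :
  (forall D, (0 < D)%N -> final_graph r.+1 D (g D)) ->
  (fun D : nat => aux_ratio R r.+1 D (g D)) =O_\oo
    (fun D : nat => (D%:R ^+ 2)^-1 : R).
Proof.
pose c := (r.+1 * (r.*2 + 4))%N; have c_gt0 : (0 < c)%N by rewrite muln_gt0 addnS.
apply: (@aux_ratio_bigO _ _ _ 2 _ _ c card_index_O3).
apply: polynomial_lower_bound => // M D M_gt0 MD.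
by apply: expn_leq_card_inv_O3; rewrite // mulnA.
Qed.

(** * Auxiliary nodes of the torus *)

Section TorusNodes.
Local Open Scope mset_scope.
Local Open Scope ring_scope.
Implicit Types (k P Q : node Torus) (e : bool).

Definition zsum k : int := \sum_(x <- k) (x : int).

Lemma zsumD k1 k2 : zsum (k1 `+` k2) = zsum k1 + zsum k2.
Proof. exact: big_msetD. Qed.

Lemma zsum1 (x : int) : zsum ([mset x] : node Torus) = x.
Proof. exact: big_mset1. Qed.

Lemma total_deg1 (x : int) : total_deg ([mset x] : node Torus) = absz x.
Proof. exact: big_mset1. Qed.

Lemma invariant_nodeE k : invariant_node k = (0 < size k)%N && (zsum k == 0).
Proof. by rewrite /invariant_node /= andbT. Qed.

(** The sign is a boolean, [false] for positive, so that both signs share the same proofs. *)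
Definition one_signed e k := forall x : int, x \in k -> 0 < (-1) ^+ e * x.

Lemma one_signedD e k1 k2 :
  one_signed e (k1 `+` k2) <-> one_signed e k1 /\ one_signed e k2.
Proof.
split=> [k12|[H1 H2] x]; last by rewrite in_msetD => /orP[/H1|/H2].
by split=> x xk; apply: k12; rewrite in_msetD xk ?orbT.
Qed.

Lemma zsum_one_signed e k : one_signed e k -> zsum k = (-1) ^+ e * (total_deg k)%:Z.
Proof.
move=> ke; rewrite /total_deg (big_morph _ PoszD (erefl _)) mulr_sumr.
rewrite /zsum big_seq [RHS]big_seq; apply: eq_bigr => x /ke /=.
by case: e {ke}; rewrite ?expr1 ?expr0; lia.
Qed.

Lemma total_deg_one_signed_gt0 e k : one_signed e k -> (0 < size k)%N ->
  (0 < total_deg k)%N.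
Proof.
move=> ke; case: (mset_0Vmem k) => [->|[x xk] _]; first by rewrite size_mset0.
apply: leq_trans (deg_le_total xk) => /=.
by have := ke x xk; case: e {ke} => /=; lia.
Qed.

(** For [P] of sign [e] this is [- zsum P]; written through the degree, its absolute value is
    immediate. *)
Definition balancing e P : int := - ((-1) ^+ e * (total_deg P)%:Z).

Definition balance e P : node Torus := [mset balancing e P] `+` P.

Lemma size_balance e P : size (balance e P) = (size P).+1.
Proof. exact: size_mset1D. Qed.

Lemma absz_balancing e P : absz (balancing e P) = total_deg P.
Proof. by rewrite /balancing; case: e => /=; lia. Qed.

Lemma total_deg_balance e P : total_deg (balance e P) = (2 * total_deg P)%N.
Proof. by rewrite total_deg_msetD total_deg1 absz_balancing mul2n addnn. Qed.

Lemma invariant_balance e P : one_signed e P -> invariant_node (balance e P).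
Proof.
move=> Pe; rewrite invariant_nodeE size_balance zsumD zsum1 /balancing.
by rewrite (zsum_one_signed Pe) addNr eqxx.
Qed.

Lemma balance_one_signedN e e' P : one_signed e P -> (0 < size P)%N ->
  ~ one_signed e' (balance e P).
Proof.
move=> Pe P_gt0 kP.
have := invariant_balance Pe; rewrite invariant_nodeE (zsum_one_signed kP).
rewrite mulf_eq0 signr_eq0 /= => /andP[/(total_deg_one_signed_gt0 kP)].
by case: total_deg.
Qed.

Lemma one_signed_noninvariant e k : one_signed e k -> (0 < size k)%N ->
  invariant_node k = false.
Proof.
move=> ke k_gt0; rewrite invariant_nodeE (zsum_one_signed ke) mulf_eq0 signr_eq0.
by have := total_deg_one_signed_gt0 ke k_gt0; case: (total_deg k) => //= n _; rewrite andbF.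
Qed.
End TorusNodes.

(** * The invariant maintained by the insertions for T *)

Section TorusGraph.
Local Open Scope mset_scope.
Local Open Scope ring_scope.
Variables nu D : nat.
Implicit Types (g : set (node Torus)) (k P Q : node Torus) (e : bool).

(** The factor 2 is there because [k] is forced into the graph by [balance e k], whose degree is
    twice that of [k]. *)
Definition torus_aux (j : nat) : set (node Torus) :=
  [set k | exists e, [/\ one_signed e k, (0 < size k)%N, (size k <= j)%N
    & (2 * total_deg k <= D)%N]].

Definition torus_sound j g := forall k, g k ->
  [\/ initial_graph Torus D k, inv_nodes_upto Torus nu D k | torus_aux j k].

(* The only decomposition of [balance e P] with nodes of the graph is the one
   that splits off the balancing element, so that [P] must be present. *)
Definition balance_closed g := forall e P, one_signed e P -> (0 < size P)%N ->
  g (balance e P) -> g P.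

(** The loop invariant: [j] bounds the order of the auxiliary nodes inserted so far. *)
Definition torus_graph j g :=
  [/\ (initial_graph Torus D `<=` g)%classic, torus_sound j g & balance_closed g].

(** Let x be the balancing element and [k1] the part containing it. If [k1] is not the singleton of
    x, it has elements of both signs, so it must be invariant. But then its other elements already
    balance x, and nothing of [P] is left for [k2]. *)
Lemma balance_decomposes j g e P k1 k2 : torus_sound j g ->
  one_signed e P -> (0 < size P)%N ->
  decomposes (balance e P) k1 k2 -> g k1 -> g k2 -> g P.
Proof.
move=> snd Pe P_gt0.
wlog xk1 : k1 k2 / balancing e P \in k1.
  move=> IH dec gk1 gk2; have [k1N0 k2N0 kE] := dec.
  have : balancing e P \in balance e P by rewrite in_msetD in_mset1 eqxx.
  rewrite kE in_msetD => /orP[xk|xk]; first exact: IH xk dec gk1 gk2.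
  by apply: (IH k2 k1) => //; split=> //; rewrite msetDC.
move=> [_ k2N0 kE] gk1 gk2; pose k1' := (k1 `\ balancing e P)%mset.
have k1E : k1 = [mset balancing e P] `+` k1' by rewrite /k1' msetB1K.
have PE : P = k1' `+` k2.
  by apply: (@msetD1_inj _ (balancing e P)); rewrite msetDA -k1E -kE.
suff k1'0 : k1' = mset0 by rewrite PE k1'0 mset0D.
have [k1'e k2e] : one_signed e k1' /\ one_signed e k2 by rewrite -one_signedD -PE.
have k2_gt0 : (0 < size k2)%N by rewrite lt0n size_mset_eq0; apply/eqP.
have x_ltP : (-1) ^+ e * balancing e P < 0.
  have := total_deg_one_signed_gt0 Pe P_gt0.
  by rewrite /balancing; case: (e) => /=; lia.
case: (snd _ gk1) => [[x _ xE]|/inv_nodes_uptoP[]|[e' [k1e' _ _ _]]].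
- have /eqP := congr1 (fun k : node Torus => size k) xE.
  rewrite k1E size_mset1D /= enum_msetn /= eqSS eq_sym.
  by rewrite size_mset_eq0 => /eqP.
- rewrite invariant_nodeE k1E zsumD zsum1 (zsum_one_signed k1'e).
  move=> /andP[_ /eqP z0] _ _.
  have := total_deg_one_signed_gt0 k2e k2_gt0.
  move: z0; rewrite /balancing PE total_deg_msetD.
  by case: (e) => /=; lia.
- case: (mset_0Vmem k1') => [//|[y yk1']].
  have x_e' := k1e' _ xk1.
  have y_e' : 0 < (-1) ^+ e' * y by apply: k1e'; rewrite k1E in_msetD yk1' orbT.
  have y_e := k1'e _ yk1'.
  by move: x_ltP x_e' y_e' y_e; case: (e); case: (e'); rewrite /=; lia.
Qed.
End TorusGraph.

(** * Effect of a single insertion for T *)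

Section TorusStep.
Local Open Scope mset_scope.
Local Open Scope ring_scope.
Variables nu D j : nat.
Implicit Types (g : set (node Torus)) (k P Q : node Torus) (e : bool).

Definition torus_complete g := forall k, inv_nodes_upto Torus nu D k ->
  (size k <= j)%N -> g k.

(** Below order [j], the node [balance e P] has order at most [j] and degree at most [D], so it is
    already present and [balance_closed] yields [P]. Singletons are initial. *)
Lemma one_signed_in g e P : (j < nu)%N -> torus_graph nu D j g -> torus_complete g ->
  one_signed e P -> (0 < size P)%N -> (size P < j)%N || (size P == 1%N) ->
  (2 * total_deg P <= D)%N -> g P.
Proof.
move=> j_nu [ini _ clo] cmp Pe P_gt0 /orP[Pj|/eqP /mset_size1[x PE]] PD; last first.
  by apply: ini; exists x => //=; move: PD; rewrite PE total_deg1; lia.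
apply: (clo e) => //; apply: cmp; last by rewrite size_balance.
apply/inv_nodes_uptoP; split; first exact: invariant_balance.
  by rewrite total_deg_balance.
by rewrite size_balance (leq_trans Pj) // ltnW.
Qed.

Lemma balanceE e P Q : one_signed e P -> zsum (P `+` Q) = 0 -> size Q = 1%N ->
  P `+` Q = balance e P.
Proof.
move=> Pe + /mset_size1[y QE]; rewrite QE zsumD (zsum_one_signed Pe) zsum1 => z0.
rewrite msetDC /balance; congr ([mset _] `+` _).
by apply/eqP; rewrite eq_sym /balancing eqr_oppLR -addr_eq0 z0.
Qed.

Lemma nondecomposable_balance g k : (j < nu)%N -> torus_graph nu D j g ->
  torus_complete g -> invariant_node k -> size k = j.+1 -> (total_deg k <= D)%N ->
  ~ g k -> (forall k1 k2, decomposes k k1 k2 -> ~ (g k1 /\ g k2)) ->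
  exists e P, [/\ one_signed e P, (1 < size P)%N, (2 * total_deg P <= D)%N
    & k = balance e P].
Proof.
move=> j_nu inv cmp kI kj kD ngk ndec; have [ini _ _] := inv.
have z0 : zsum k = 0 by move: kI; rewrite invariant_nodeE => /andP[_ /eqP].
(* A zero could be split off: its singleton is initial and the rest, if nonempty, is an invariant
   node of order [j], inserted before. *)
have k_n0 : (0 : int) \notin k.
  apply/negP => k_0; have kE := mset_split k_0; set k' := (k `\ _)%mset in kE.
  have g0 : g [mset (0 : int)] by apply: ini; exists (0 : int).
  have [k'0|k'N0] := eqVneq k' mset0; first by apply: ngk; rewrite kE k'0 msetD0.
  apply: (ndec [mset (0 : int)] k') => //.
    by split => //; [exact: mset1_neq0|exact/eqP].
  split => //; apply: cmp; last by rewrite -ltnS -kj kE size_mset1D.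
  apply/inv_nodes_uptoP; split.
  - rewrite invariant_nodeE lt0n size_mset_eq0 k'N0 /=.
    by rewrite -z0 [X in _ == zsum X]kE zsumD zsum1 add0r.
  - by apply: leq_trans kD; rewrite kE total_deg_msetD leq_addl.
  - by rewrite (leq_trans _ j_nu) // -kj kE size_mset1D leqnSn.
pose P : node Torus := seq_mset [seq x <- k | 0 < (x : int)].
pose Q : node Torus := seq_mset [seq x <- k | ~~ (0 < (x : int))].
have kE : k = P `+` Q := mset_filterC (fun x : int => 0 < x) k.
have Pe : one_signed false P.
  by move=> x; rewrite mem_seq_mset mem_filter expr0 mul1r => /andP[].
have Qe : one_signed true Q.
  move=> x; rewrite mem_seq_mset mem_filter expr1 mulN1r oppr_gt0 => /andP[x0 xk].
  by rewrite lt_neqAle leNgt x0 andbT; apply: contraNneq k_n0 => <-.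
have PQ_deg : total_deg P = total_deg Q.
  by move: z0; rewrite kE zsumD (zsum_one_signed Pe) (zsum_one_signed Qe) /=; lia.
have PQ_size : (size P + size Q = j.+1)%N by rewrite -size_msetD -kE.
have PD : (2 * total_deg P <= D)%N.
  by apply: leq_trans kD; rewrite kE total_deg_msetD -PQ_deg mul2n addnn.
have QD : (2 * total_deg Q <= D)%N by rewrite -PQ_deg.
have deg0 (k' : node Torus) : size k' = 0%N -> total_deg k' = 0%N.
  by move/eqP; rewrite size_mset_eq0 => /eqP->; rewrite /total_deg big_mset0.
have P_deg := total_deg_one_signed_gt0 Pe; have Q_deg := total_deg_one_signed_gt0 Qe.
have [/[dup] P0 /deg0 P_deg0|P_gt0] := posnP (size P); first by lia.
have [/[dup] Q0 /deg0 Q_deg0|Q_gt0] := posnP (size Q); first by lia.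
have PinE := one_signed_in j_nu inv cmp Pe P_gt0 _ PD.
have QinE := one_signed_in j_nu inv cmp Qe Q_gt0 _ QD.
have ngPQ : ~ (g P /\ g Q).
  apply: ndec; split => //; apply/eqP; rewrite -size_mset_eq0 -lt0n //.
(* The sizes add up to [j.+1]. If both are at least 2, both are below [j]; hence [P] and [Q] are
   both present unless exactly one of them is a singleton. *)
case: (eqVneq (size Q) 1%N) => [Q1|Q1].
  case: (ltnP 1 (size P)) => [P1|P1]; last first.
    by case: ngPQ; split; [apply: PinE|apply: QinE]; lia.
  by exists false, P; split => //; rewrite kE (balanceE Pe) // -kE.
case: (eqVneq (size P) 1%N) => [P1|P1].
  exists true, Q; split => //; first by lia.
  by rewrite kE msetDC (balanceE Qe) // msetDC -kE.
by case: ngPQ; split; [apply: PinE|apply: QinE]; lia.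
Qed.

Lemma torus_graph_insert g k g' : (j < nu)%N -> torus_graph nu D j g ->
  torus_complete g -> invariant_node k -> size k = j.+1 -> (total_deg k <= D)%N ->
  insert g k g' -> torus_graph nu D j g'.
Proof.
move=> j_nu inv cmp kI kj kD ins; have [ini snd clo] := inv.
have k_upto : inv_nodes_upto Torus nu D k by apply/inv_nodes_uptoP; split; rewrite ?kj.
case: (insert_inv ins) => [->//|[k1 [k2 [dec gk1 gk2 ->]]]|].
  split.
  - by move=> x /ini gx; right.
  - by move=> x [->|/snd//]; constructor 2.
  - move=> e P Pe P_gt0 [PkE|/(clo _ _ Pe P_gt0)]; last by right.
    by right; rewrite -PkE in dec; exact: balance_decomposes snd Pe P_gt0 dec gk1 gk2.
move=> [g1 [x [k' [[ngk ndec] dec x_max ins1 ins']]]].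
have [e [P [Pe P_gt1 PD kE]]] :=
  nondecomposable_balance j_nu inv cmp kI kj kD ngk ndec.
have P_gt0 : (0 < size P)%N := ltnW P_gt1.
have PN0 : P <> mset0 by move=> P0; rewrite P0 size_mset0 in P_gt0.
(* As [P] has at least two elements, each is smaller in absolute value than their sum. The element
   of largest degree is therefore the balancing one, and the tie-breaking has no effect. *)
have xE : x = balancing e P.
  have : x \in balance e P.
    by rewrite -kE; case: dec => _ _ ->; rewrite in_msetD in_mset1 eqxx.
  rewrite in_msetD in_mset1 => /orP[/eqP//|xP].
  have := x_max (balancing e P); rewrite {1}kE in_msetD in_mset1 eqxx => /(_ isT).
  have PE := mset_split xP; set P' := (P `\ x)%mset in PE.
  have P'e : one_signed e P' by move: Pe; rewrite PE => /one_signedD[].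
  have := total_deg_one_signed_gt0 P'e; move: P_gt1; rewrite PE size_mset1D ltnS.
  move=> P'_gt0 /(_ P'_gt0); rewrite /deg /= absz_balancing total_deg_msetD total_deg1.
  by lia.
have k'E : k' = P.
  by case: dec => _ _; rewrite kE xE /balance => /msetD1_inj.
rewrite {}k'E in dec ins1.
have gx : g [mset x].
  by apply: ini; exists x => //; rewrite xE /= absz_balancing; lia.
have ngP : ~ g P by move=> gP; exact: (ndec _ _ dec).
have P_k : P <> k.
  by move=> Pk; apply: (balance_one_signedN (e' := e) Pe P_gt0); rewrite -kE -Pk.
have Pj : size P = j by apply/eqP; rewrite -eqSS -(size_balance e P) -kE kj.
(* The recursion stops here: [P] splits into any of its elements, which is initial, and a remainder
   of order below [j], which is present by [one_signed_in]. *)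
have {ins1} g1E : g1 = (P |` g)%classic.
  case: (insert_inv ins1) => [g1E|[? [? [_ _ _ ->//]]]|].
    by case: ngP; rewrite -g1E; exact: insert_in ins1.
  move=> [_ [_ [_ [[_ ndecP] _ _ _ _]]]]; exfalso.
  case: (mset_0Vmem P) => [//|[y yP]]; have PE := mset_split yP.
  set P' := (P `\ y)%mset in PE.
  have [ye P'e] : one_signed e ([mset y] : node Torus) /\ one_signed e P'.
    by move: Pe; rewrite PE => /one_signedD.
  have P'_size : (size P').+1 = j by rewrite -Pj [in RHS]PE size_mset1D.
  have PD' := PD; rewrite PE total_deg_msetD total_deg1 in PD'.
  have P'_gt0 : (0 < size P')%N by rewrite -ltnS P'_size -Pj.
  apply: (ndecP [mset y] P').
    split => //; first exact: mset1_neq0.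
    by move=> P'0; rewrite P'0 size_mset0 in P'_gt0.
  split; first by apply: ini; exists y => //=; lia.
  by apply: (one_signed_in j_nu inv cmp P'e) => //; [rewrite -P'_size ltnSn|lia].
have g1P : g1 P by rewrite g1E; left.
have g1x : g1 [mset x] by rewrite g1E; right.
(* The second call finds the decomposition of [k] into the balancing element and [P], both present
   by now. *)
have -> : g' = (k |` g1)%classic.
  case: (insert_inv ins') => [g'E|[? [? [_ _ _ ->//]]]|].
    have := insert_in ins'; rewrite g'E g1E => -[kP|//].
    by case: P_k.
  by move=> [_ [_ [_ [[_ /(_ _ _ dec)[]]]]]].
have snd1 : torus_sound nu D j g1.
  move=> y; rewrite g1E => -[->|/snd//]; constructor 3.
  by exists e; split => //; rewrite Pj.
split.
- by move=> y /ini gy; right; rewrite g1E; right.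
- by move=> y [->|/snd1//]; constructor 2.
- move=> e' P' P'e P'_gt0 [P'kE|]; last rewrite g1E => -[P'E|].
  + right; rewrite -P'kE in dec.
    exact: balance_decomposes snd1 P'e P'_gt0 dec g1x g1P.
  + by case: (balance_one_signedN (e' := e) P'e P'_gt0); rewrite P'E.
  + by move/(clo _ _ P'e P'_gt0) => gP'; right; right.
Qed.
End TorusStep.

(** * The final graph for T *)

Section TorusFinal.
Local Open Scope mset_scope.
Local Open Scope ring_scope.
Variables nu D : nat.
Implicit Types (g : set (node Torus)) (k P : node Torus) (s : seq (node Torus)).

Lemma torus_graph_leq i j g : (i <= j)%N -> torus_graph nu D i g -> torus_graph nu D j g.
Proof.
move=> ij [ini snd clo]; split => // k /snd[?|?|[e [? ? ki ?]]].
- by constructor 1.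
- by constructor 2.
- by constructor 3; exists e; split => //; exact: leq_trans ij.
Qed.

Lemma torus_graph_initial : torus_graph nu D 0 (initial_graph Torus D).
Proof.
split => // [k|e P Pe P_gt0 [x _ /(congr1 (fun k : node Torus => size k))]].
  by constructor 1.
by rewrite size_balance enum_msetn /= => -[P0]; rewrite -P0 in P_gt0.
Qed.

(** The remaining nodes are sorted by order, so when [k] comes next every invariant node of smaller
    order is already present. This is the completeness that [torus_graph_insert] requires at level
    [(size k).-1]. *)
Lemma torus_graph_insert_all j g s g' : insert_all g s g' -> (j < nu)%N ->
  sorted leq [seq size (enum_mset k) | k <- s] ->
  (forall k, k \in s -> inv_nodes_upto Torus nu D k /\ (j < size k)%N) ->
  (forall k, inv_nodes_upto Torus nu D k -> k \in s \/ g k) ->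
  torus_graph nu D j g ->
  torus_graph nu D nu.-1 g' /\ (inv_nodes_upto Torus nu D `<=` g')%classic.
Proof.
move=> ins; elim: ins j => {g s g'} [g j j_nu _ _ cmp inv|].
  split; last by move=> k /cmp[].
  by apply: torus_graph_leq inv; rewrite -ltnS prednK //; exact: leq_ltn_trans j_nu.
move=> g g1 g' k s ins _ IH j j_nu /= s_sorted s_inv cmp inv.
have [k_upto kj] := s_inv k (mem_head _ _).
have /inv_nodes_uptoP[kI kD k_nu] := k_upto.
have k_min k' : k' \in s -> (size k <= size k')%N.
  move=> k's; have := order_path_min leq_trans s_sorted => /allP; apply.
  exact: map_f.
pose i := (size k).-1; have iE : i.+1 = size k by rewrite prednK // (leq_ltn_trans _ kj).
have ji : (j <= i)%N by rewrite -ltnS iE.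
have i_nu : (i < nu)%N by rewrite iE.
have inv_i := torus_graph_leq ji inv.
have cmp_i : torus_complete nu D i g.
  move=> k' /cmp[]//; rewrite inE => /orP[/eqP->|/k_min]; first by rewrite -iE ltnn.
  by rewrite -iE => /leq_trans h /h; rewrite ltnn.
have inv1 := torus_graph_insert i_nu inv_i cmp_i kI (esym iE) kD ins.
apply: (IH i) => //; first exact: path_sorted s_sorted.
- move=> k' k's; split; first by have [] := s_inv k'; rewrite // inE k's orbT.
  by rewrite iE k_min.
- move=> k' /cmp[|gk']; last by right; exact: insert_subset ins _ gk'.
  by rewrite inE => /orP[/eqP->|]; [right; exact: insert_in ins|left].
Qed.

(** One inclusion is soundness. Conversely, for one-signed [k] of order below [nu], the invariant
    node [balance e k] is in the final graph, which forces [k] by [balance_closed]; and [k] itself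
    has nonzero sum. *)
Lemma aux_nodes_torus g : (0 < nu)%N -> final_graph nu D g ->
  aux_nodes nu D g =
  [set k | exists e, [/\ one_signed e k, (2 <= size k)%N, (size k < nu)%N
    & (2 * total_deg k <= D)%N]].
Proof.
move=> nu_gt0 [s [_ sE s_sorted ins]].
have sP (k : node Torus) : k \in s <-> inv_nodes_upto Torus nu D k by rewrite -sE.
have [] := torus_graph_insert_all ins nu_gt0 s_sorted _ _ torus_graph_initial.
- by move=> k /sP k_upto; split => //; case: k_upto => i /andP[? _] [_ _ ->].
- by move=> k /sP; left.
move=> [_ snd clo] cmp; apply/seteqP; split => k /=.
  move=> [/snd[[x _ <-]|//|[e [ke _ k_nu kD]]]]; first by rewrite enum_msetn.
  by move=> k2 _; exists e; split => //; rewrite -ltnS prednK in k_nu.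
move=> [e [ke k2 k_nu kD]]; have k_gt0 := ltnW k2; split => //.
  apply: (clo e) => //; apply: cmp; apply/inv_nodes_uptoP.
  by rewrite size_balance total_deg_balance; split => //; exact: invariant_balance.
by move=> /inv_nodes_uptoP[]; rewrite (one_signed_noninvariant ke).
Qed.
End TorusFinal.

(** * Counting by partitions *)

Section Partitions.
Local Open Scope nat_scope.

Definition partitions (p n : nat) : set (seq nat) :=
  [set s | [/\ sorted geq s, all (leq 1) s, size s = p & sumn s = n]].

(** No part of a partition of n exceeds n, so the bounded tuples counted by [num_partitions] miss
    none. *)
Lemma partitions_image (p n : nat) : partitions p n =
  (fun t : p.-tuple 'I_n.+1 => [seq nat_of_ord i | i <- t]) @`
    [set t : p.-tuple 'I_n.+1 | let s := [seq nat_of_ord i | i <- t] in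
      [&& sorted geq s, all (fun i => 0 < i) s & sumn s == n]].
Proof.
apply/seteqP; split => [s [s_srt s_gt0 sp sn]|_ [t /= /and3P[? ? /eqP ?] <-]]; last first.
  by split; rewrite // size_map size_tuple.
have s_le i : i \in s -> i <= n.
  by move=> /perm_to_rem/perm_sumn; rewrite /= sn => ->; rewrite leq_addr.
have sE : [seq nat_of_ord i | i <- map (fun i => inord i : 'I_n.+1) s] = s.
  rewrite -map_comp -[RHS]map_id; apply/eq_in_map => i /s_le i_le /=.
  by rewrite inordK.
have tp : size (map (fun i => inord i : 'I_n.+1) s) == p by rewrite size_map sp.
by exists (Tuple tp); rewrite /= sE // s_srt s_gt0 sn eqxx.
Qed.

Lemma card_partitions (p n : nat) : card_set (partitions p n) = num_partitions p n.
Proof.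
rewrite partitions_image card_set_in_image ?card_set_finType //.
by move=> s t _ _ /inj_map eq_st; apply/val_inj/eq_st/val_inj.
Qed.

Lemma finite_partitions (p n : nat) : finite_set (partitions p n).
Proof. by rewrite partitions_image; apply: finite_image. Qed.

Lemma num_partitions0 (n : nat) : num_partitions 0 n = (n == 0).
Proof.
rewrite -card_partitions; case: eqP => [->|n0].
  rewrite (_ : partitions 0 0 = [set [::]]); first by rewrite /card_set fset_set1 cardfs1.
  by apply/seteqP; split=> s /=; [case=> _ _ /size0nil|move=> ->].
rewrite (_ : partitions 0 n = set0) ?card_set0 //.
by apply/seteqP; split=> // s [_ _ /size0nil -> /esym].
Qed.

Lemma num_partitions_n0 (p : nat) : num_partitions p.+1 0 = 0.
Proof.
rewrite -card_partitions (_ : partitions _ _ = set0) ?card_set0 //.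
by apply/seteqP; split=> // -[|x s] [_ //] /= /andP[x0 _] _ /eqP; lia.
Qed.

(* A partition either has last part 1, which is removed, or all its parts are at
   least 2, and each is decreased by 1. *)
Lemma num_partitionsS (p n : nat) :
  num_partitions p.+1 (n + p.+1) = num_partitions p (n + p) + num_partitions p.+1 n.
Proof.
have geq_trans : transitive geq by move=> x y z /= xy /leq_trans; apply.
have sumS s : sumn (map S s) = sumn s + size s.
  by elim: s => //= x s ->; lia.
have inj1 : injective (fun s => rcons s 1) by move=> s t /rcons_inj[].
have injS : injective (map S) by apply: inj_map => x y [].
rewrite -!card_partitions.
rewrite -[X in _ = X + _](@card_set_in_image _ _ (fun s => rcons s 1)); last exact: in2W.
rewrite -[X in _ = _ + X](@card_set_in_image _ _ (map S)); last exact: in2W.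
rewrite -card_setU; last first.
- apply/disj_setPS => s /= [[t _ <-] [u [_ u_gt0 _ _]]].
  have : 1 \in rcons t 1 by rewrite mem_rcons mem_head.
  move=> /[swap] <- /mapP[x xu [x0]].
  by have := allP u_gt0 _ xu; rewrite -x0.
- exact/finite_image/finite_partitions.
- exact/finite_image/finite_partitions.
congr card_set; apply/seteqP; split=> [s|_ [[s [s_srt s_gt0 sp sn] <-]|[s [s_srt s_gt0 sp sn] <-]]].
- case: (lastP s) => [[_ _ //]|{}s x []]; rewrite sorted_pairwise //.
  rewrite pairwise_rcons -sorted_pairwise // all_rcons size_rcons sumn_rcons.
  move=> /andP[x_min s_srt] /andP[x_gt0 s_gt0] [sp] sn.
  have [x1|x_neq1] := eqVneq x 1.
    by left; exists s; [split => //; move: sn; rewrite x1; lia|rewrite x1].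
  have x_gt1 : 1 < x by lia.
  have sE : map S (map predn (rcons s x)) = rcons s x.
    rewrite -map_comp -[RHS]map_id; apply/eq_in_map => y /=.
    rewrite mem_rcons inE => /orP[/eqP->|/(allP s_gt0)]; last by case: y.
    by rewrite prednK.
  right; exists (map predn (rcons s x)) => //; split.
  + rewrite sorted_pairwise // pairwise_map.
    apply: (@sub_pairwise _ geq); first by move=> y z /=; lia.
    by rewrite pairwise_rcons x_min -sorted_pairwise.
  + rewrite all_map; apply/allP => y; rewrite mem_rcons inE /=.
    by move=> /orP[/eqP->|/(allP x_min) /=]; lia.
  + by rewrite size_map size_rcons sp.
  + have := sumS (map predn (rcons s x)).
    by rewrite sE size_map size_rcons sp sumn_rcons sn => /addIn.
- split; rewrite ?size_rcons ?sp ?all_rcons //; last by rewrite sumn_rcons sn; lia.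
  by rewrite sorted_pairwise // pairwise_rcons -sorted_pairwise // s_srt andbT.
- split; rewrite ?size_map // ?all_map //; last by rewrite sumS sn sp.
    by rewrite sorted_map; apply: sub_sorted s_srt => x y.
  by apply/allP.
Qed.
End Partitions.

(** * Nodes of the torus as signed partitions *)

Section SignedParts.
Local Open Scope mset_scope.
Local Open Scope ring_scope.
Implicit Types (e : bool) (s t : seq nat) (u : seq int).

Definition signed e s : seq int := [seq (-1) ^+ e * i%:Z | i <- s].

Definition has_sign e : pred int := fun x => 0 < (-1) ^+ e * x.

Definition parts u : seq nat := sort geq [seq absz x | x <- u].

Lemma partsE e p n u : all (has_sign e) u -> size u = p ->
  (\sum_(x <- u) absz x)%N = n ->
  partitions p n (parts u) /\ perm_eq (signed e (parts u)) u.
Proof.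
move=> ue up un; have perm_u : perm_eq (parts u) [seq absz x | x <- u].
  by rewrite /parts perm_sort.
split; first split.
- by apply: sort_sorted => x y; rewrite /geq /= leq_total.
- rewrite (perm_all _ perm_u) all_map; apply: sub_all ue => x.
  by rewrite /has_sign /=; case: (e) => /=; lia.
- by rewrite (perm_size perm_u) size_map.
- by rewrite sumnE (perm_big _ perm_u) big_map.
apply: (perm_trans (perm_map _ perm_u)); rewrite -map_comp map_id_in // => x.
by move=> /(allP ue); rewrite /has_sign /=; case: (e) => /=; lia.
Qed.

Lemma all_signed e p n s : partitions p n s -> all (has_sign e) (signed e s).
Proof.
move=> [_ s_gt0 _ _]; rewrite all_map; apply: sub_all s_gt0 => i /=.
by rewrite /has_sign; case: e => /=; lia.
Qed.

Lemma perm_signed_inj e p q n m s t : partitions p n s -> partitions q m t ->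
  perm_eq (signed e s) (signed e t) -> s = t.
Proof.
move=> [s_srt _ _ _] [t_srt _ _ _] st.
apply: (@sorted_eq _ geq) => //.
- by move=> x y z /= yx /leq_trans; apply.
- by move=> x y /=; rewrite andbC -eqn_leq => /eqP.
apply: perm_map_inj st => i j /=; by case: e => /=; lia.
Qed.

Lemma sum_absz_signed e s : (\sum_(x <- signed e s) absz x)%N = sumn s.
Proof.
rewrite big_map sumnE; apply: eq_bigr => i _.
by case: e => /=; lia.
Qed.

Lemma sum_signed e s : \sum_(x <- signed e s) x = (-1) ^+ e * (sumn s)%:Z.
Proof.
by rewrite big_map -mulr_sumr -(big_morph _ PoszD (erefl _)) -sumnE.
Qed.

(** Sorting the absolute values inverts the passage from a partition to its signed multiset. *)
Lemma card_one_signed e p n :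
  card_set [set k : node Torus | [/\ one_signed e k, size k = p & total_deg k = n]] =
  num_partitions p n.
Proof.
rewrite -card_partitions.
rewrite -(@card_set_in_image _ _ (fun s => seq_mset (signed e s) : node Torus)); last first.
  move=> s t /set_mem sp /set_mem tp /eq_seq_msetP.
  exact: perm_signed_inj sp tp.
congr card_set; apply/seteqP; split=> [k [ke kp kn]|_ [s sP <-]].
  have [|kP k_perm] := @partsE e p n (enum_mset k : seq int) _ kp kn; first by apply/allP => x /ke.
  exists (parts (enum_mset k : seq int)) => //.
  by rewrite (eq_seq_msetP _ _ k_perm) seq_mset_id.
have := all_signed e sP; case: (sP) => _ _ sp sn s_all; split.
- by move=> x; rewrite mem_seq_mset => /(allP s_all).
- by rewrite size_seq_mset size_map.
- by rewrite /total_deg big_seq_mset -sn; exact: sum_absz_signed.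
Qed.

Definition pos_count (k : node Torus) := count (has_sign false) (enum_mset k : seq int).
Definition neg_count (k : node Torus) := count (has_sign true) (enum_mset k : seq int).

Definition assemble (z : nat) (st : seq nat * seq nat) : seq int :=
  signed false st.1 ++ signed true st.2 ++ nseq z 0.

(** Filtering by sign reads off the two partitions. This gives both the injectivity of [assemble]
    and the sign counts of the assembled node. *)
Lemma filter_assemble e z s t p q n m : partitions p n s -> partitions q m t ->
  [seq x <- assemble z (s, t) | has_sign e x] = signed e (if e then t else s).
Proof.
move=> sP tP; rewrite /assemble !filter_cat /=.
have other e' p' n' s' : partitions p' n' s' ->
    [seq x <- signed e' s' | has_sign (~~ e') x] = [::].
  move=> /(all_signed e') s'P; rewrite -(filter_pred0 (signed e' s')).
  apply: eq_in_filter => x /(allP s'P).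
  by rewrite /has_sign; case: (e') => /=; lia.
have own e' p' n' s' : partitions p' n' s' ->
    [seq x <- signed e' s' | has_sign e' x] = signed e' s'.
  by move=> /(all_signed e') /all_filterP.
have zeros : [seq x <- nseq z 0 | has_sign e x] = [::].
  by rewrite filter_nseq /has_sign mulr0 ltxx.
rewrite zeros; case: e {zeros} => /=.
  by rewrite (other false _ _ _ sP) (own true _ _ _ tP) cats0.
by rewrite (own false _ _ _ sP) (other true _ _ _ tP) !cats0.
Qed.

Lemma assemble_inj z p q n m : {in (partitions p n `*` partitions q m)%classic &,
  injective (fun st => seq_mset (assemble z st))}.
Proof.
move=> [s t] [s' t'] /set_mem[/= sP tP] /set_mem[/= s'P t'P] /eq_seq_msetP eq_st.
have := perm_filter (has_sign false) eq_st; have := perm_filter (has_sign true) eq_st.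
rewrite !(filter_assemble _ _ sP tP) !(filter_assemble _ _ s'P t'P).
by move=> /(perm_signed_inj tP t'P) -> /(perm_signed_inj sP s'P) ->.
Qed.

Lemma perm_signs u : perm_eq ([seq x <- u | has_sign false x] ++
  [seq x <- u | has_sign true x] ++ [seq x <- u | pred1 0 x]) u.
Proof.
apply: perm_trans (permEl (perm_filterC (has_sign false) u)); rewrite perm_cat2l.
apply: perm_trans (permEl (perm_filterC (has_sign true) _)).
rewrite -!filter_predI (@eq_filter _ (predI (has_sign true) _) (has_sign true)); last first.
  by move=> x; rewrite /has_sign /=; lia.
rewrite perm_cat2l (@eq_filter _ (predI _ _) (pred1 0)) //.
by move=> x; rewrite /has_sign /=; lia.
Qed.

(** The sum vanishes exactly when the positive and the negative parts partition the same integer n,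
    and then the degree is 2 n. The elements not counted by p and q are zeros. *)
Lemma assemble_invariant (j p q n D : nat) : (0 < j)%N -> (p + q <= j)%N ->
  (n <= D %/ 2)%N ->
  [set k : node Torus | [/\ inv_nodes Torus j D k, pos_count k = p,
     neg_count k = q & (total_deg k %/ 2)%N = n]] =
  (fun st => seq_mset (assemble (j - (p + q)) st)) @` (partitions p n `*` partitions q n)%classic.
Proof.
move=> j_gt0 pqj nD; apply/seteqP; split=> [k|_ [[s t] [/= sP tP] <-]]; last first.
  have [_ _ sp sn] := sP; have [_ _ tq tn] := tP.
  have count_e e : count (has_sign e) (seq_mset (assemble (j - (p + q)) (s, t))) =
      if e then q else p.
    have /permP -> := perm_eq_seq_mset (assemble (j - (p + q)) (s, t)).
    by rewrite -size_filter (filter_assemble _ _ sP tP) size_map; case: e.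
  have degE : total_deg (seq_mset (assemble (j - (p + q)) (s, t)) : node Torus) = (2 * n)%N.
    rewrite /total_deg big_seq_mset !big_cat /= !sum_absz_signed sn tn.
    by rewrite big_nseq iter_addn_0 mul0n addn0 mul2n addnn.
  split; [split|exact: count_e false|exact: count_e true|].
  - rewrite invariant_nodeE /zsum size_seq_mset !size_cat !size_map size_nseq sp tq.
    rewrite addnA subnKC // j_gt0 big_seq_mset !big_cat /= !sum_signed sn tn.
    by rewrite big_nseq iter_addr_0 mul0rn addr0 /= expr0 expr1 mul1r mulN1r subrr.
  - by rewrite degE mulnC -leq_divRL.
  - by rewrite size_seq_mset !size_cat !size_map size_nseq sp tq addnA subnKC.
  - by rewrite degE mulKn.
move=> [[kI kD kj] kp kq kn].
have z0 : zsum k = 0 by move: kI; rewrite invariant_nodeE => /andP[_ /eqP].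
pose u := [seq x <- (enum_mset k : seq int) | has_sign false x].
pose v := [seq x <- (enum_mset k : seq int) | has_sign true x].
have up : size u = p by rewrite size_filter.
have vq : size v = q by rewrite size_filter.
have k_perm : perm_eq (u ++ v ++ nseq (j - (p + q)) 0) (enum_mset k : seq int).
  have := perm_signs (enum_mset k : seq int); rewrite -/u -/v => k_perm.
  have /all_pred1P w0 := filter_all (pred1 (0 : int)) (enum_mset k : seq int).
  have := perm_size k_perm; rewrite !size_cat up vq kj => w_size.
  have -> : (j - (p + q))%N = size [seq x <- (enum_mset k : seq int) | pred1 0 x].
    by rewrite subnDA -[X in (X - p - q)%N]w_size !addKn.
  by rewrite -w0.
have [uP u_perm] := @partsE false p _ u (filter_all _ _) up erefl.
have [vP v_perm] := @partsE true q _ v (filter_all _ _) vq erefl.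
have {u_perm v_perm}k_perm :
    perm_eq (assemble (j - (p + q)) (parts u, parts v)) (enum_mset k : seq int).
  by apply: perm_trans k_perm; apply: perm_cat => //; rewrite perm_cat2r.
have [_ _ _ us] := uP; have [_ _ _ vs] := vP.
have uv : sumn (parts u) = sumn (parts v).
  move: z0; rewrite /zsum -(perm_big _ k_perm) !big_cat /= !sum_signed.
  by rewrite big_nseq iter_addr_0 mul0rn addr0 /= expr0 expr1; lia.
have un : sumn (parts u) = n.
  rewrite -kn /total_deg -(perm_big _ k_perm) !big_cat /= !sum_absz_signed.
  by rewrite big_nseq iter_addn_0 mul0n addn0 -uv addnn -muln2 mulnK.
exists (parts u, parts v).
  by split; rewrite /= -{1}un; [rewrite us|rewrite uv vs].
by rewrite -[RHS]seq_mset_id; apply/eq_seq_msetP.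
Qed.
End SignedParts.

(** * Exact numbers of nodes for T *)

Section TorusCount.
Local Open Scope nat_scope.

Lemma card_aux_nodes_torus (nu D : nat) (g : set (node Torus)) :
  2 <= nu -> final_graph nu D g ->
  card_set (aux_nodes nu D g) =
    2 * \sum_(2 <= k < nu) \sum_(1 <= n < (D %/ 2).+1) num_partitions k n.
Proof.
move=> nu_ge2 fg; have auxE := aux_nodes_torus (ltnW nu_ge2) fg.
pose A (e : bool) := [set k : node Torus |
  [/\ one_signed e k, 2 <= size k, size k < nu & 2 * total_deg k <= D]].
have AE : aux_nodes nu D g = A false `|` A true.
  rewrite auxE; apply/seteqP; split=> [k [[] kA]|k [kA|kA]];
    by [left|right|exists false|exists true].
have finA e : finite_set (A e).
  apply: sub_finite_set (finite_aux_nodes fg); rewrite AE.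
  by case: e; [right|left].
have fin (P Q : set (node Torus)) : finite_set P -> finite_set [set k | P k /\ Q k].
  by move=> finP; apply: sub_finite_set finP => k [].
rewrite AE card_setU //; last first.
  apply/disj_setPS => k /= [[ke k2 _ _] [ke' _ _ _]].
  case: (mset_0Vmem k) k2 => [->|[x xk] _]; first by rewrite size_mset0.
  by have := ke x xk; have := ke' x xk; rewrite /=; lia.
suff cardA e : card_set (A e) =
    \sum_(2 <= k < nu) \sum_(1 <= n < (D %/ 2).+1) num_partitions k n.
  by rewrite !cardA addnn mul2n.
rewrite (@card_set_fibers _ _ (fun k : node Torus => size k) nu) //; last by move=> k [].
rewrite (@big_cat_nat _ _ _ 2) //= [X in X + _]big_nat_cond big1 ?add0n; last first.
  move=> i /andP[/andP[_ i2] _].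
  rewrite (_ : [set k | _] = set0) ?card_set0 //.
  apply/seteqP; split=> // k /= [[_ k2 _ _] ki].
  by move: i2; rewrite -ki ltnNge k2.
apply: eq_big_nat => i /andP[i2 i_nu].
rewrite (@card_set_fibers _ _ (@total_deg Torus) (D %/ 2).+1); last 2 first.
- exact/fin/finA.
- by move=> k [[_ _ _ kD] _]; rewrite ltnS leq_divRL // mulnC.
have part_fiber n : n < (D %/ 2).+1 ->
    card_set [set k : node Torus | (A e k /\ size k = i) /\ total_deg k = n] =
    num_partitions i n.
  rewrite ltnS => nD; rewrite -(card_one_signed e); congr card_set.
  apply/seteqP; split=> k /= [].
    by case=> -[ke _ _ _] ki kn.
  move=> ke ki kn; split => //; split => //; split; rewrite ?ki ?kn //.
  by rewrite mulnC -leq_divRL.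
(* The fiber of degree 0 is counted by the partitions of 0 into [i] positive parts, of which there
   are none. *)
rewrite big_ltn // part_fiber //.
case: i i2 {i_nu} part_fiber => // i i2 part_fiber.
rewrite num_partitions_n0 add0n; apply: eq_big_nat => n /andP[_ n_lt].
exact: part_fiber.
Qed.

(** Successive fibers over the order j, the sign counts p and q, and half the degree n. Impossible
    triples have empty fibers, so the ranges need not depend on one another. *)
Lemma card_inv_nodes_torus (nu D : nat) :
  card_set (inv_nodes_upto Torus nu D) =
  \sum_(0 <= j < nu.+1) \sum_(0 <= p < nu.+1) \sum_(0 <= q < nu.+1)
    \sum_(0 <= n < (D %/ 2).+1)
      (if (0 < j) && (p + q <= j) then num_partitions p n * num_partitions q n
       else 0).
Proof.
have fin (P Q : set (node Torus)) : finite_set P -> finite_set [set k | P k /\ Q k].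
  by move=> finP; apply: sub_finite_set finP => k [].
have finK := finite_inv_nodes_upto Torus nu D.
have count_disj (k : node Torus) : pos_count k + neg_count k <= size k.
  rewrite /pos_count /neg_count -(count_predC (has_sign false) k) leq_add2l.
  by apply: sub_count => x; rewrite /has_sign /=; lia.
rewrite (@card_set_fibers _ _ (fun k : node Torus => size k) nu.+1) //; last first.
  by move=> k /inv_nodes_uptoP[].
apply: eq_big_nat => j /andP[_ j_nu].
rewrite (@card_set_fibers _ _ pos_count nu.+1); last 2 first.
- exact: fin.
- move=> k [_ kj]; rewrite ltnS -ltnS; apply: leq_ltn_trans j_nu.
  by rewrite -kj (leq_trans _ (count_disj k)) // leq_addr.
apply: eq_big_nat => p _.
rewrite (@card_set_fibers _ _ neg_count nu.+1); last 2 first.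
- exact/fin/fin.
- move=> k [[_ kj] _]; rewrite ltnS -ltnS; apply: leq_ltn_trans j_nu.
  by rewrite -kj (leq_trans _ (count_disj k)) // leq_addl.
apply: eq_big_nat => q _.
rewrite (@card_set_fibers _ _ (fun k : node Torus => total_deg k %/ 2) (D %/ 2).+1);
  last 2 first.
- exact/fin/fin/fin.
- by move=> k [[[/inv_nodes_uptoP[_ kD _] _] _] _]; rewrite ltnS leq_div2r.
apply: eq_big_nat => n /andP[_ n_lt].
case: ifP => [/andP[j_gt0 pqj]|pqj]; last first.
  rewrite (_ : [set k | _] = set0) ?card_set0 //.
  apply/seteqP; split=> // k [[[[/inv_nodes_uptoP[kI _ _] kj] kp] kq] _] /=.
  move/negP: pqj; apply; rewrite -kj -kp -kq count_disj andbT.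
  by move: kI; rewrite invariant_nodeE => /andP[].
rewrite -(card_partitions p) -(card_partitions q) -card_setX; try exact: finite_partitions.
rewrite -(card_set_in_image (@assemble_inj (j - (p + q)) p q n n)).
rewrite -(@assemble_invariant j p q n D) //.
congr card_set; apply/seteqP; split=> k /=.
  move=> [[[[/inv_nodes_uptoP[kI kD _] kj] kp] kq] kn].
  by split.
move=> [[kI kD kj] kp kq kn]; do !split => //.
by apply/inv_nodes_uptoP; split; rewrite // kj.
Qed.
End TorusCount.

(** * Asymptotics *)

Section Asymptotics.
Variable R : realType.
Implicit Types (u v b : nat -> R) (l d c : R).

(** Discards the index 0, where quotients by powers of n are degenerate. *)
Lemma eq_cvg_pos u v l : (forall n, (0 < n)%N -> u n = v n) ->
  u @ \oo --> l -> v @ \oo --> l.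
Proof.
move=> uv; apply: cvg_trans; apply: near_eq_cvg; near=> n; rewrite uv //.
by near: n; exact: nbhs_infty_ge.
Unshelve. all: by end_near. Qed.

Lemma cvg_sum_seq (I : eqType) (s : seq I) (u : I -> nat -> R) (l : I -> R) :
  (forall i, i \in s -> u i @ \oo --> l i) ->
  (fun n => \sum_(i <- s) u i n) @ \oo --> \sum_(i <- s) l i.
Proof.
elim: s => [|i s IHs] us.
  rewrite big_nil; under eq_fun do rewrite big_nil.
  exact: cvg_cst.
rewrite big_cons; under eq_fun do rewrite big_cons.
apply: cvgD; first by apply: us; rewrite mem_head.
by apply: IHs => j js; apply: us; rewrite inE js orbT.
Qed.

Lemma cvg_exprn u l (r : nat) : u @ \oo --> l -> (fun n => u n ^+ r) @ \oo --> l ^+ r.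
Proof.
move=> ul; elim: r => [|r IHr]; first exact: cvg_cst.
by rewrite exprS; under eq_fun do rewrite exprS; exact: cvgM.
Qed.

Lemma cvg_natV : (fun n => n%:R^-1 : R) @ \oo --> (0 : R).
Proof. by rewrite -cvg_shiftS; exact: cvg_harmonic. Qed.

Lemma cvg_natXV (r : nat) : (0 < r)%N -> (fun n => (n%:R ^+ r)^-1 : R) @ \oo --> (0 : R).
Proof.
move=> r_gt0; have -> : 0 = 0 ^+ r :> R by rewrite expr0n gtn_eqF.
by under eq_fun do rewrite -exprVn; exact: cvg_exprn cvg_natV.
Qed.

Lemma cvg_shift_ratio (k : nat) : (fun n => (n + k)%:R / n%:R : R) @ \oo --> (1 : R).
Proof.
apply: (@eq_cvg_pos (fun n => 1 + k%:R * n%:R^-1)) => [n n_gt0|].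
  by rewrite natrD mulrDl divff // pnatr_eq0 -lt0n.
rewrite -[X in _ --> X]addr0 -[X in _ --> _ + X](mulr0 k%:R).
by apply: cvgD; [exact: cvg_cst|apply: cvgM; [exact: cvg_cst|exact: cvg_natV]].
Qed.

Lemma cvg_shift_div u (k r : nat) l : (fun n => u n / n%:R ^+ r) @ \oo --> l ->
  (fun n => u (n + k)%N / n%:R ^+ r) @ \oo --> l.
Proof.
move=> ul.
apply: (@eq_cvg_pos (fun n =>
    u (n + k)%N / (n + k)%:R ^+ r * ((n + k)%:R / n%:R) ^+ r)) => [n n_gt0|].
  rewrite expr_div_n mulrA mulfVK //.
  by rewrite expf_eq0 pnatr_eq0 addn_eq0 (gtn_eqF n_gt0) andbF.
rewrite -[l]mulr1 -[X in l * X](expr1n _ r).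
apply: cvgM; last exact/cvg_exprn/cvg_shift_ratio.
by rewrite (@cvg_shiftn k _ (fun n => u n / n%:R ^+ r)).
Qed.

(** Induction through (n + k)^(r+2) - n^(r+2) = (n + k) ((n + k)^(r+1) - n^(r+1)) + k n^(r+1). *)
Lemma cvg_pow_diff (k r : nat) :
  (fun n => ((n + k)%:R ^+ r.+1 - n%:R ^+ r.+1) / n%:R ^+ r : R) @ \oo -->
  ((k * r.+1)%:R : R).
Proof.
elim: r => [|r IHr].
  apply: (@eq_cvg_pos (fun=> k%:R)) => [n _|]; last by rewrite muln1; exact: cvg_cst.
  by rewrite !expr1 expr0 divr1 natrD addrC addKr.
apply: (@eq_cvg_pos (fun n => (n + k)%:R / n%:R *
    (((n + k)%:R ^+ r.+1 - n%:R ^+ r.+1) / n%:R ^+ r) + k%:R)) => [n n_gt0|].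
  have n_neq0 : n%:R != 0 :> R by rewrite pnatr_eq0 -lt0n.
  rewrite mulf_div -exprS -[X in _ + X](mulfK (expf_neq0 r.+1 n_neq0)) -mulrDl.
  by congr (_ / _); rewrite mulrBr -exprS natrD !exprS; ring.
have -> : (k * r.+2)%:R = 1 * (k * r.+1)%:R + k%:R :> R.
  by rewrite mul1r -natrD mulnSr addnC.
apply: cvgD; last exact: cvg_cst.
by apply: cvgM => //; exact: cvg_shift_ratio.
Qed.

(** The bound |b n| <= E + (eps / 2) n^(r+1) propagates from n - k to n, and E is absorbed for large
    n. The case of a nonzero limit reduces to this one by subtracting a multiple of n^(r+1). *)
Lemma cvg0_step_diff b (k r : nat) : (0 < k)%N ->
  (fun n => (b (n + k)%N - b n) / n%:R ^+ r) @ \oo --> (0 : R) ->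
  (fun n => b n / n%:R ^+ r.+1) @ \oo --> (0 : R).
Proof.
move=> k_gt0 diff0; apply/cvgr0Pnorm_le => eps eps_gt0.
have eps2_gt0 : 0 < eps / 2 by rewrite divr_gt0.
have [N _ N_diff] : \forall n \near \oo,
    `|(b (n + k)%N - b n) / n%:R ^+ r| <= eps / 2.
  exact: cvgr0_norm_le diff0 _ eps2_gt0.
(* Large enough for all the base cases n < N + 1 + k at once. *)
pose E := \sum_(i < N.+1 + k) `|b i|.
have b_le n : `|b n| <= E + eps / 2 * n%:R ^+ r.+1.
  elim/ltn_ind: n => n IHn; have [n_lt|n_ge] := ltnP n (N.+1 + k).
    rewrite /E (bigD1 (Ordinal n_lt)) //= -addrA lerDl addr_ge0 ?sumr_ge0 //.
    by rewrite mulr_ge0 // ltW.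
  have nE : n = (n - k + k)%N by rewrite subnK // (leq_trans _ n_ge) // leq_addl.
  set m := (n - k)%N in nE; have N_m : (N < m)%N by rewrite /m ltn_subRL addnC.
  have m_gt0 : (0 < m)%N by exact: leq_ltn_trans N_m.
  have := N_diff m (ltnW N_m); rewrite -nE normrM normfV normrX normr_nat.
  rewrite ler_pdivrMr ?exprn_gt0 ?ltr0n // => diff_le.
  have := IHn m; rewrite {1}nE -[X in (X < _)%N]addn0 ltn_add2l => /(_ k_gt0) bm_le.
  rewrite -[b n](subrK (b m)); apply: le_trans (ler_normD _ _) _.
  apply: le_trans (lerD diff_le bm_le) _.
  rewrite addrC -addrA lerD2l -mulrDr ler_wpM2l ?(ltW eps2_gt0) //.
  (* m^r + m^(r+1) = (m + 1) m^r <= (m + 1)^(r+1) <= n^(r+1), as n = m + k with k positive. *)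
  apply: (@le_trans _ _ (m.+1%:R ^+ r.+1)).
    rewrite exprS -[X in _ + X]mul1r -mulrDl addrC exprS.
    rewrite -natr1 addrC ler_wpM2l ?addr_ge0 //.
    by rewrite lerXn2r ?nnegrE ?addr_ge0 // lerDl.
  by rewrite lerXn2r ?nnegrE // ler_nat nE -addn1 leq_add2l.
near=> n.
have n_gt0 : (0 < n)%N by near: n; exact: nbhs_infty_ge.
have nr_gt0 : 0 < n%:R ^+ r.+1 :> R by rewrite exprn_gt0 ?ltr0n.
rewrite normrM normfV (ger0_norm (ltW nr_gt0)) ler_pdivrMr //.
apply: le_trans (b_le n) _; rewrite -lerBrDr -mulrBl.
rewrite [X in _ <= X * _](_ : _ = eps / 2); last by lra.
rewrite -ler_pdivrMr //; near: n.
have : (fun n => E * (n%:R ^+ r.+1)^-1) @ \oo --> (0 : R).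
  rewrite -[X in _ --> X](mulr0 E).
  by apply: cvgM; [exact: cvg_cst|exact: cvg_natXV].
move=> /cvgr0_norm_le /(_ _ eps2_gt0); apply: filterS => n.
exact: le_trans (ler_norm _).
Unshelve. all: by end_near. Qed.

(* Stolz-Cesaro for differences of step [k]. *)
Lemma cvg_step_diff b (k r : nat) d : (0 < k)%N ->
  (fun n => (b (n + k)%N - b n) / n%:R ^+ r) @ \oo --> d ->
  (fun n => b n / n%:R ^+ r.+1) @ \oo --> d / (k * r.+1)%:R.
Proof.
move=> k_gt0 diff; set c := d / _.
have kr_neq0 : (k * r.+1)%:R != 0 :> R by rewrite pnatr_eq0 muln_eq0 negb_or -lt0n k_gt0.
apply: (@eq_cvg_pos
    (fun n => (b n - c * n%:R ^+ r.+1) / n%:R ^+ r.+1 + c)) => [n n_gt0|].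
  by rewrite mulrBl mulfK ?subrK // expf_neq0 // pnatr_eq0 -lt0n.
rewrite -[X in _ --> X]add0r; apply: cvgD; last exact: cvg_cst.
apply: (cvg0_step_diff k_gt0).
have -> : (0 : R) = d - c * (k * r.+1)%:R by rewrite /c divfK // subrr.
apply: (@eq_cvg_pos (fun n => (b (n + k)%N - b n) / n%:R ^+ r -
    c * (((n + k)%:R ^+ r.+1 - n%:R ^+ r.+1) / n%:R ^+ r))) => [n _|].
  by rewrite mulrA -mulrBl; congr (_ / _); ring.
by apply: cvgB => //; apply: cvgM; [exact: cvg_cst|exact: cvg_pow_diff].
Qed.

Lemma cvg_cesaro b (r : nat) d : (fun n => b n / n%:R ^+ r) @ \oo --> d ->
  (fun N => (\sum_(0 <= n < N.+1) b n) / N%:R ^+ r.+1) @ \oo --> d / r.+1%:R.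
Proof.
move=> bd.
have := @cvg_step_diff (fun N => \sum_(0 <= n < N.+1) b n) 1 r d isT.
rewrite mul1n; apply.
apply: (@eq_cvg_pos (fun n => b (n + 1)%N / n%:R ^+ r)) => [n _|].
  by rewrite addn1 [in RHS]big_nat_recr //= [X in _ = X / _]addrAC subrr add0r.
exact: cvg_shift_div.
Qed.

(** By [num_partitionsS], the differences of step p + 2 of pi(p + 2, n) are shifted values of pi(p +
    1, n), so each induction step divides the constant by (p + 2)(p + 1). The base case is pi(1, n)
    = 1 for positive n. *)
Lemma cvg_num_partitions (p : nat) :
  (fun n => (num_partitions p.+1 n)%:R / n%:R ^+ p : R) @ \oo -->
  (((p.+1)`! * p`!)%:R^-1 : R).
Proof.
elim: p => [|p IHp].
  have parts1 n : num_partitions 1 n.+1 = 1%N.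
    elim: n => [|n IHn]; rewrite -[X in num_partitions _ X]addn1 num_partitionsS.
      by rewrite num_partitions0 num_partitions_n0.
    by rewrite num_partitions0 IHn.
  apply: (@eq_cvg_pos (fun=> 1)) => [[//|n] _|]; last by rewrite invr1; exact: cvg_cst.
  by rewrite parts1 divr1.
have -> : ((p.+2)`! * (p.+1)`!)%:R^-1 = ((p.+1)`! * p`!)%:R^-1 / (p.+2 * p.+1)%:R :> R.
  by rewrite -invfM -natrM; congr (_%:R^-1); rewrite !factS; ring.
apply: (@cvg_step_diff (fun n => (num_partitions p.+2 n)%:R)) => //.
apply: (@eq_cvg_pos (fun n => (num_partitions p.+1 (n + p.+1))%:R / n%:R ^+ p)) => [n _|].
  by rewrite (num_partitionsS p.+1) natrD addrK.
exact: (@cvg_shift_div (fun n => (num_partitions p.+1 n)%:R)).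
Qed.
End Asymptotics.

(** * The limit of the ratio for T *)

Section TorusLimit.
Variables (R : realType) (r : nat).

(** This count and the next ones are for order nu = r + 2 and depend on the degree bound only
    through N = D / 2, rounded down. *)
Definition aux_count (N : nat) : nat :=
  (2 * \sum_(2 <= k < r.+2) \sum_(1 <= n < N.+1) num_partitions k n)%N.

Definition inv_count_term (N j p q : nat) : nat :=
  (\sum_(0 <= n < N.+1) if (0 < j) && (p + q <= j)
    then num_partitions p n * num_partitions q n else 0)%N.

Definition inv_count (N : nat) : nat :=
  (\sum_(0 <= j < r.+3) \sum_(0 <= p < r.+3) \sum_(0 <= q < r.+3)
     inv_count_term N j p q)%N.

Lemma cvg_div_higher_power (u : nat -> R) (i m : nat) (l : R) : (i <= m)%N ->
  (fun n => u n / n%:R ^+ i) @ \oo --> l ->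
  (fun n => u n / n%:R ^+ m) @ \oo --> (if i == m then l else 0 : R).
Proof.
case: ltngtP => // [i_m _ ul|-> //].
apply: (@eq_cvg_pos _ (fun n => u n / n%:R ^+ i * (n%:R ^+ (m - i))^-1)) => [n n_gt0|].
  rewrite -mulrA -invfM -exprD subnKC //; exact: ltnW.
rewrite -[X in _ --> X](mulr0 l); apply: cvgM => //.
by apply: cvg_natXV; rewrite subn_gt0.
Qed.

(** Summing pi(k, n) over n <= N gives a quantity equivalent to N^k / k!^2, so only k = r + 1
    contributes to the limit; it lies in the range because r is positive. *)
Lemma cvg_aux_count : (0 < r)%N ->
  (fun N => (aux_count N)%:R / N%:R ^+ r.+1 : R) @ \oo -->
  (2 / ((r.+1)`!%:R ^+ 2) : R).
Proof.
move=> r_gt0; pose L k : R := if k == r.+1 then ((r.+1)`!%:R ^+ 2)^-1 else 0.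
have -> : 2 / ((r.+1)`!%:R ^+ 2) = 2 * \sum_(2 <= k < r.+2) L k.
  rewrite big_nat_recr //= big_nat_cond big1 ?add0r /L ?eqxx // => k.
  by move=> /andP[/andP[_ k_r] _]; rewrite ltn_eqF.
apply: (@eq_cvg_pos _ (fun N => 2 * \sum_(k <- index_iota 2 r.+2)
   ((\sum_(0 <= n < N.+1) num_partitions k n)%:R / N%:R ^+ r.+1))) => [N N_gt0|].
  rewrite -mulr_suml -natr_sum mulrA -natrM; congr (_%:R / _); congr (_ * _)%N.
  apply: eq_big_nat => -[//|k] _.
  by rewrite big_ltn // num_partitions_n0 add0n.
apply: cvgM; first exact: cvg_cst.
apply: cvg_sum_seq => -[|k]; rewrite mem_index_iota // => /andP[_ k_r].
have := @cvg_div_higher_power _ k.+1 r.+1 _ k_r (cvg_cesaro (@cvg_num_partitions R k)).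
under eq_fun do rewrite -natr_sum.
rewrite /L; case: eqVneq => [[->]|//].
congr (_ --> _); rewrite -invfM -natrM -natrX; congr (_%:R^-1).
by rewrite !factS; ring.
Qed.

(** For positive p and q the sum grows like N^(p+q-1) with p + q <= j <= r + 2, so the full exponent
    is reached only by nodes of maximal order without zeros. If p or q is 0, only n = 0 can
    contribute, and the sum is bounded. *)
Lemma cvg_inv_count_term (j p q : nat) : (j < r.+3)%N ->
  (fun N => (inv_count_term N j p q)%:R / N%:R ^+ r.+1 : R) @ \oo -->
  (if [&& j == r.+2, (0 < p)%N, (0 < q)%N & (p + q == r.+2)%N]
   then ((p`! * p.-1`!)%:R^-1 * (q`! * q.-1`!)%:R^-1) / r.+1%:R else 0 : R).
Proof.
move=> j_r; have const0 (c : nat) : (fun N => c%:R / N%:R ^+ r.+1 : R) @ \oo --> (0 : R).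
  apply: (@cvg_div_higher_power (fun=> c%:R) 0 r.+1 c%:R) => //.
  under eq_fun do rewrite expr0 divr1.
  exact: cvg_cst.
rewrite /inv_count_term.
have [pqj|pqj] := boolP ((0 < j)%N && (p + q <= j)%N); last first.
  rewrite ifF; last by apply/negP => /and4P[]; lia.
  by under eq_fun do rewrite big1 //; exact: (const0 0%N).
case: p pqj => [|p] pqj.
  rewrite /= andbF.
  apply: (@eq_cvg_pos _ (fun N => (num_partitions q 0)%:R / N%:R ^+ r.+1)) => [N _|//].
  rewrite big_ltn // num_partitions0 mul1n big_nat_cond big1 ?addn0 //.
  by move=> [|n] //; rewrite num_partitions0.
case: q pqj => [|q] pqj.
  rewrite /= andbF.
  apply: (@eq_cvg_pos _ (fun N => (num_partitions p.+1 0)%:R / N%:R ^+ r.+1)) => [N _|//].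
  rewrite big_ltn // num_partitions0 muln1 big_nat_cond big1 ?addn0 //.
  by move=> [|n] //; rewrite num_partitions0 muln0.
have prod_cvg : (fun n => (num_partitions p.+1 n * num_partitions q.+1 n)%:R
      / n%:R ^+ (p + q) : R) @ \oo -->
    (((p.+1)`! * p`!)%:R^-1 * ((q.+1)`! * q`!)%:R^-1 : R).
  apply: (@eq_cvg_pos _ (fun n => (num_partitions p.+1 n)%:R / n%:R ^+ p *
      ((num_partitions q.+1 n)%:R / n%:R ^+ q))) => [n _|].
    by rewrite mulf_div -natrM exprD.
  by apply: cvgM; exact: cvg_num_partitions.
have pq_r : (p + q <= r)%N by lia.
have := @cvg_div_higher_power _ (p + q).+1 r.+1 _ pq_r (cvg_cesaro prod_cvg).
under eq_fun do rewrite -natr_sum.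
have -> : [&& j == r.+2, (0 < p.+1)%N, (0 < q.+1)%N & (p.+1 + q.+1 == r.+2)%N] =
    ((p + q).+1 == r.+1).
  by apply/and4P/eqP => [[]|?]; [lia|split; lia].
by case: eqVneq => [[->]|].
Qed.

(** Each summand is C(r + 2, p + 1) C(r, p) / ((r + 2)! r!), and Vandermonde's identity applies
    after replacing C(r, p) by C(r, r - p). *)
Lemma sum_inv_bin :
  \sum_(0 <= p < r.+1) ((p.+1)`! * p`!)%:R^-1 * ((r.+1 - p)`! * (r - p)`!)%:R^-1 =
  'C(2 * r.+1, r.+1)%:R / ((r.+2)`! * r`!)%:R :> R.
Proof.
have <- : \sum_(0 <= p < r.+1) 'C(r.+2, p.+1) * 'C(r, p) = 'C(2 * r.+1, r.+1) :> nat.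
  have -> : (2 * r.+1 = r.+2 + r)%N by lia.
  (* The first term of the convolution vanishes because C(r, r + 1) = 0; the others are shifted by
     one. *)
  rewrite -binomial.Vandermonde big_ord_recl /= subn0 (bin_small (ltnSn r)) muln0 add0n big_mkord.
  by apply: eq_bigr => p _; rewrite /bump leq0n add1n subSS bin_sub // -ltnS.
rewrite natr_sum mulr_suml; apply: eq_big_nat => p /andP[_ p_r].
have fact_neq0 n : n`!%:R != 0 :> R by rewrite pnatr_eq0 -lt0n fact_gt0.
have p_r1 : (p.+1 <= r.+2)%N by lia.
have /(congr1 (fun n => n%:R : R)) := bin_fact p_r1.
have /(congr1 (fun n => n%:R : R)) := bin_fact (p_r : p <= r)%N.
rewrite subSS !natrM => <- <-.
have bin1 : 'C(r.+2, p.+1)%:R != 0 :> R by rewrite pnatr_eq0 -lt0n bin_gt0.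
have bin2 : 'C(r, p)%:R != 0 :> R by rewrite pnatr_eq0 -lt0n bin_gt0.
move: bin1 bin2 (fact_neq0 p.+1) (fact_neq0 p) (fact_neq0 (r.+1 - p)%N) (fact_neq0 (r - p)%N).
move: ('C(r.+2, p.+1)%:R : R) ('C(r, p)%:R : R) ((p.+1)`!%:R : R) (p`!%:R : R)
  ((r.+1 - p)`!%:R : R) ((r - p)`!%:R : R) => b1 b2 f1 f2 f3 f4 *.
by field; do ?[apply/andP; split].
Qed.

Lemma cvg_inv_count :
  (fun N => (inv_count N)%:R / N%:R ^+ r.+1 : R) @ \oo -->
  ('C(2 * r.+1, r.+1)%:R / ((r.+2)`! * (r.+1)`!)%:R : R).
Proof.
pose L j p q : R :=
  if [&& j == r.+2, (0 < p)%N, (0 < q)%N & (p + q == r.+2)%N]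
  then ((p`! * p.-1`!)%:R^-1 * (q`! * q.-1`!)%:R^-1) / r.+1%:R else 0.
have -> : 'C(2 * r.+1, r.+1)%:R / ((r.+2)`! * (r.+1)`!)%:R =
    \sum_(0 <= j < r.+3) \sum_(0 <= p < r.+3) \sum_(0 <= q < r.+3) L j p q.
  rewrite big_nat_recr //= [X in _ = X + _]big_nat_cond big1 ?add0r; last first.
    move=> j /andP[/andP[_ j_r] _]; rewrite big1 // => p _; rewrite big1 // => q _.
    by rewrite /L ltn_eqF.
  (* The values p = 0 and p = r + 2 contribute nothing. Splitting off the first shifts p by one,
     which leaves q = r + 1 - p as the only nonzero term. *)
  rewrite big_nat_recl // [X in _ = X + _]big1 ?add0r; last first.
    by move=> q _; rewrite /L andbF.
  rewrite big_nat_recr //= [X in _ = _ + X]big_nat_cond [X in _ = _ + X]big1 ?addr0; last first.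
    by move=> q _; rewrite /L; case: ifP => // /and4P[]; lia.
  have -> : 'C(2 * r.+1, r.+1)%:R / ((r.+2)`! * (r.+1)`!)%:R =
      'C(2 * r.+1, r.+1)%:R / ((r.+2)`! * r`!)%:R / r.+1%:R :> R.
    by rewrite -mulrA -invfM -natrM; congr (_ / _%:R); rewrite [(r.+1)`!]factS; ring.
  rewrite -sum_inv_bin mulr_suml; apply: eq_big_nat => p /andP[_ p_r].
  rewrite (bigD1_seq (r.+1 - p)%N) ?iota_uniq ?mem_index_iota //=; last by lia.
  rewrite big1 ?addr0 => [|q q_neq]; last first.
    by rewrite /L; case: ifP => // /and4P[]; lia.
  rewrite /L ifT ?subSn //; last by apply/and4P; split; lia.
apply: (@eq_cvg_pos _ (fun N => \sum_(j <- index_iota 0 r.+3)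
    \sum_(p <- index_iota 0 r.+3) \sum_(q <- index_iota 0 r.+3)
    ((inv_count_term N j p q)%:R / N%:R ^+ r.+1))) => [N _|].
  rewrite /inv_count !natr_sum mulr_suml; apply: eq_bigr => j _.
  rewrite natr_sum mulr_suml; apply: eq_bigr => p _.
  by rewrite natr_sum mulr_suml.
apply: cvg_sum_seq => j; rewrite mem_index_iota => /andP[_ j_r].
apply: cvg_sum_seq => p _; apply: cvg_sum_seq => q _.
exact: cvg_inv_count_term.
Qed.

(** This amounts to (r + 1) C(2 r + 2, r + 1) = (r + 2) C(2 r + 2, r). *)
Lemma bin_catalan :
  'C(2 * r.+2 - 2, r.+2 - 2)%:R / (r.+2 - 1)%:R = catalan R (r.+2 - 1).
Proof.
have -> : (2 * r.+2 - 2 = 2 * r.+1)%N by lia.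
rewrite /catalan !subSS !subn0.
have := mul_bin_left (2 * r.+1) r; have -> : (2 * r.+1 - r = r.+2)%N by lia.
move=> /(congr1 (fun n => n%:R : R)); rewrite !natrM => binE.
have r1 : r.+1%:R != 0 :> R by rewrite pnatr_eq0.
have r2 : r.+2%:R != 0 :> R by rewrite pnatr_eq0.
by apply/eqP; rewrite eqr_div // mulrC -binE mulrC.
Qed.

(** With a and k the leading coefficients of the two counts, the limit is a / (a + k), and k / a is
    half the Catalan number. *)
Lemma cvg_count_ratio : (0 < r)%N ->
  (fun N => (aux_count N)%:R / (aux_count N + inv_count N)%:R : R) @ \oo -->
  ((1 + catalan R r.+1 / 2)^-1 : R).
Proof.
move=> r_gt0; set a : R := 2 / ((r.+1)`!%:R ^+ 2).
set k : R := 'C(2 * r.+1, r.+1)%:R / ((r.+2)`! * (r.+1)`!)%:R.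
have fact_gt0 n : 0 < n`!%:R :> R by rewrite ltr0n fact_gt0.
have a_gt0 : 0 < a by rewrite /a divr_gt0 // exprn_gt0.
have k_ge0 : 0 <= k by rewrite /k divr_ge0.
have -> : (1 + catalan R r.+1 / 2)^-1 = a / (a + k).
  have -> : catalan R r.+1 = 2 * k / a.
    have fE : (r.+2)`!%:R = r.+2%:R * (r.+1)`!%:R :> R by rewrite factS natrM.
    rewrite /catalan /k /a natrM fE.
    have r2 : r.+2%:R != 0 :> R by rewrite pnatr_eq0.
    move: r2 (lt0r_neq0 (fact_gt0 r.+1)).
    move: (r.+2%:R : R) ((r.+1)`!%:R : R) ('C(2 * r.+1, r.+1)%:R : R) => x y z *.
    by field; do ?[apply/andP; split].
  have ak_gt0 : 0 < a + k by rewrite ltr_wpDr.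
  by field; rewrite !lt0r_neq0.
apply: (@eq_cvg_pos _ (fun N => (aux_count N)%:R / N%:R ^+ r.+1 *
   ((aux_count N)%:R / N%:R ^+ r.+1 + (inv_count N)%:R / N%:R ^+ r.+1)^-1)) => [N N_gt0|].
  have N_neq0 : N%:R ^+ r.+1 != 0 :> R by rewrite expf_neq0 // pnatr_eq0 -lt0n.
  by rewrite -mulrDl invfM invrK mulrACA [X in _ * X]mulVf // mulr1 natrD.
apply: cvgM; first exact: cvg_aux_count.
apply: cvgV; first by rewrite gt_eqF // ltr_wpDr.
by apply: cvgD; [exact: cvg_aux_count|exact: cvg_inv_count].
Qed.

Lemma aux_ratio_torusE (D : nat) (g : set (node Torus)) : final_graph r.+2 D g ->
  aux_ratio R r.+2 D g = (aux_count (D %/ 2))%:R /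
    (aux_count (D %/ 2) + inv_count (D %/ 2))%:R.
Proof.
move=> fg; rewrite /aux_ratio /all_nodes card_setU; last 3 first.
- exact: finite_aux_nodes fg.
- exact: finite_inv_nodes_upto.
- by apply/disj_setPS => k [[]].
by rewrite (card_aux_nodes_torus _ fg) // card_inv_nodes_torus.
Qed.

Lemma cvg_aux_ratio_torus (g : nat -> set (node Torus)) : (0 < r)%N ->
  (forall D, (0 < D)%N -> final_graph r.+2 D (g D)) ->
  (fun D => aux_ratio R r.+2 D (g D)) @ \oo --> ((1 + catalan R r.+1 / 2)^-1 : R).
Proof.
move=> r_gt0 fg.
apply: (@eq_cvg_pos _ (fun D => (aux_count (D %/ 2))%:R /
    (aux_count (D %/ 2) + inv_count (D %/ 2))%:R)) => [D /fg fgD|].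
  by rewrite aux_ratio_torusE.
have half_oo : (fun D : nat => (D %/ 2)%N) @ \oo --> \oo.
  move=> A [N _ NA]; exists (2 * N)%N => // D /= ND; apply: NA => /=.
  by rewrite leq_divRL // mulnC.
exact: (@cvg_comp _ _ _ (fun D => D %/ 2)%N _ _ _ _ half_oo (cvg_count_ratio r_gt0)).
Qed.
End TorusLimit.

Theorem theorem3p2 (R : realType) (nu : nat) (hnu : (3 <= nu)%N) :
  [/\ forall g : nat -> set (node SO2),
        (forall D, (0 < D)%N -> final_graph nu D (g D)) ->
        (fun D : nat => aux_ratio R nu D (g D)) =O_\oo
          (fun D : nat => D%:R^-1 : R),
      forall g : nat -> set (node O3),
        (forall D, (0 < D)%N -> final_graph nu D (g D)) ->
        (fun D : nat => aux_ratio R nu D (g D)) =O_\oo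
          (fun D : nat => (D%:R ^+ 2)^-1 : R),
      forall (D : nat) (g : set (node Torus)),
        (0 < D)%N -> final_graph nu D g ->
        card_set (aux_nodes nu D g) =
          (2 * \sum_(2 <= k < nu) \sum_(1 <= n < (D %/ 2).+1)
                 num_partitions k n)%N
    & let C : R := 'C(2 * nu - 2, nu - 2)%:R / (nu - 1)%:R in
      C = catalan R (nu - 1) /\
      (forall g : nat -> set (node Torus),
        (forall D, (0 < D)%N -> final_graph nu D (g D)) ->
        (fun D : nat => aux_ratio R nu D (g D)) @ \oo --> (1 + C / 2)^-1)].
Proof.
(* With nu = r + 2, the hypothesis 3 <= nu computes to 0 < r. *)
case: nu hnu => [|[|r]] // r_gt0; split.
- exact: aux_ratio_SO2.
- exact: aux_ratio_O3.
- by move=> D g _; exact: card_aux_nodes_torus.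
- move=> C; have CE : C = catalan R (r.+2 - 1) := bin_catalan R r.
  split=> // g fg; rewrite CE subn1; exact: cvg_aux_ratio_torus.
Qed.
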